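(* The system $\textsf{M}$ proves $\textsf{WKL}^{\mathrm{st}}$, i.e. weak König's lemma relative to the standardness predicate.
   Context: Weak König's lemma $\textsf{WKL}$: for every binary tree $T$ (a set, given by its characteristic function $T\le_11$, of codes of finite $0$-$1$ sequences which is closed under initial segments), if $(\forall n^0)(\exists\alpha^0)(|\alpha|=n\wedge\alpha\in T)$ then $(\exists\alpha^1\le_11)(\forall n^0)(\overline{\alpha}n\in T)$. Here $|\alpha|$ is the length of the finite sequence $\alpha$ and $\overline{\alpha}n$ is the initial segment of $\alpha^1$ of length $n$. For a formula $A$, $A^{\mathrm{st}}$ is obtained by appending `st' to all quantifiers (except bounded number quantifiers), i.e. replacing $\forall,\exists$ by $\forall^{\mathrm{st}},\exists^{\mathrm{st}}$. Type $0$ is the type of natural numbers, $1$ is $0\to0$; superscripts denote types. $\textsf{E-PA}^{\omega}$ is classical Peano arithmetic in all finite types with the axiom of extensionality. Strong majorizability $\le^*$: $x\le^*_0y$ is $x\le_0y$, and $x\le^*_{\rho\to\sigma}y$ is $(\forall v)(\forall u\le^*_\rho v)(xu\le^*_\sigma yv\wedge yu\le^*_\sigma yv)$. An object $x$ is monotone if $x\le^*x$; $\tilde\forall,\tilde\exists$ denote quantifiers over monotone objects. The language of $\textsf{E-PA}^{\omega}_{\mathrm{st}}$ adds a predicate $\mathrm{st}^\sigma$ (``is standard'') for each finite type $\sigma$. A formula is internal if it does not involve $\mathrm{st}$. $(\forall^{\mathrm{st}}x)\Phi$ is $(\forall x)(\mathrm{st}(x)\to\Phi)$ and $(\exists^{\mathrm{st}}x)\Phi$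 is $(\exists x)(\mathrm{st}(x)\wedge\Phi)$. $\textsf{E-PA}^{\omega}_{\mathrm{st}}$ is $\textsf{E-PA}^{\omega}$ plus: (1) $x=_\sigma y\to(\mathrm{st}(x)\to\mathrm{st}(y))$; (2) $\mathrm{st}(y)\to(x\le^*_\sigma y\to\mathrm{st}(x))$; (3) $\mathrm{st}(t)$ for each closed term $t$; (4) $\mathrm{st}(z^{\sigma\to\tau})\to(\mathrm{st}(x^\sigma)\to\mathrm{st}(zx))$; and external induction $\Phi(0)\wedge(\forall^{\mathrm{st}}n^0)(\Phi(n)\to\Phi(n+1))\to(\forall^{\mathrm{st}}n^0)\Phi(n)$ for any $\Phi$. $\textsf{M}$ is $\textsf{E-PA}^{\omega}_{\mathrm{st}}$ plus, for internal $\varphi$: monotone choice $\textsf{mAC}^\omega_{\mathrm{st}}$: $(\tilde\forall^{\mathrm{st}}x)(\tilde\exists^{\mathrm{st}}y)\varphi(x,y)\to(\tilde\exists^{\mathrm{st}}f)(\tilde\forall^{\mathrm{st}}x)(\exists y\le^*f(x))\varphi(x,y)$; realization $\textsf{R}^\omega$: $(\forall x)(\exists^{\mathrm{st}}y)\varphi(x,y)\to(\tilde\exists^{\mathrm{st}}z)(\forall x)(\exists y\le^*z)\varphi(x,y)$; and $\textsf{MAJ}^\omega_{\mathrm{st}}$: $(\forall^{\mathrm{st}}x)(\exists^{\mathrm{st}}y)(x\le^*y)$. *)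

(* Defs.v *)
From Stdlib Require Import List.
Import ListNotations.

Set Implicit Arguments.
Unset Strict Implicit.

Inductive ty : Type :=
| N : ty
| Arr : ty -> ty -> ty.

Declare Scope ty_scope.
Delimit Scope ty_scope with ty.
Bind Scope ty_scope with ty.
Notation "a ⇒ b" := (Arr a b) (at level 60, right associativity) : ty_scope.
Local Open Scope ty_scope.

(** Well-typed de Bruijn indices; the head of the context is the variable
    bound last. *)
Definition ctx := list ty.

Inductive var : ctx -> ty -> Type :=
| vz (Γ : ctx) (σ : ty) : var (σ :: Γ) σ
| vs (Γ : ctx) (σ τ : ty) : var Γ τ -> var (σ :: Γ) τ.
Arguments vz {Γ σ}.
Arguments vs {Γ σ τ} _.

(** [CK] and [CS] are the combinators usually written Π and Σ; [CR] is
    Gödel's recursor. *)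
Inductive cst : ty -> Type :=
| C0 : cst N
| CSucc : cst (N ⇒ N)
| CK (ρ τ : ty) : cst (ρ ⇒ τ ⇒ ρ)
| CS (δ ρ τ : ty) : cst ((δ ⇒ ρ ⇒ τ) ⇒ (δ ⇒ ρ) ⇒ δ ⇒ τ)
| CR (ρ : ty) : cst (N ⇒ ρ ⇒ (ρ ⇒ N ⇒ ρ) ⇒ ρ).

Inductive tm (Γ : ctx) : ty -> Type :=
| Var (σ : ty) : var Γ σ -> tm Γ σ
| Cst (σ : ty) : cst σ -> tm Γ σ
| App (σ τ : ty) : tm Γ (σ ⇒ τ) -> tm Γ σ -> tm Γ τ.
Arguments Var {Γ σ} _.
Arguments Cst {Γ σ} _.
Arguments App {Γ σ τ} _ _.

Declare Scope tm_scope.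
Delimit Scope tm_scope with tm.
Bind Scope tm_scope with tm.
Notation "s · t" := (App s t) (at level 40, left associativity) : tm_scope.
Local Open Scope tm_scope.

Definition zero {Γ} : tm Γ N := Cst C0.
Definition succ {Γ} : tm Γ (N ⇒ N) := Cst CSucc.
Definition cK {Γ ρ τ} : tm Γ (ρ ⇒ τ ⇒ ρ) := Cst (CK ρ τ).
Definition cS {Γ δ ρ τ} : tm Γ ((δ ⇒ ρ ⇒ τ) ⇒ (δ ⇒ ρ) ⇒ δ ⇒ τ) :=
  Cst (CS δ ρ τ).
Definition cR {Γ ρ} : tm Γ (N ⇒ ρ ⇒ (ρ ⇒ N ⇒ ρ) ⇒ ρ) := Cst (CR ρ).
Definition one {Γ} : tm Γ N := succ · zero.

Definition v0 {Γ a} : tm (a :: Γ) a := Var vz.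
Definition v1 {Γ a b} : tm (b :: a :: Γ) a := Var (vs vz).
Definition v2 {Γ a b c} : tm (c :: b :: a :: Γ) a := Var (vs (vs vz)).

Definition renaming (Γ Δ : ctx) := forall σ, var Γ σ -> var Δ σ.
Definition substitution (Γ Δ : ctx) := forall σ, var Γ σ -> tm Δ σ.

Definition on_head (F : ty -> Type) (σ : ty) (Γ : ctx)
    (h : F σ) (r : forall τ, var Γ τ -> F τ) :
    forall τ, var (σ :: Γ) τ -> F τ :=
  fun τ v =>
    match v in var Δ τ' return
      match Δ with
      | [] => unit
      | σ' :: Γ' => F σ' -> (forall τ'', var Γ' τ'' -> F τ'') -> F τ'
      end
    with
    | vz => fun h _ => h
    | vs v' => fun _ r => r _ v'
    end h r.

Definition shift {Γ} {σ : ty} : renaming Γ (σ :: Γ) := fun _ v => vs v.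

Definition ren_up {Γ Δ} {σ : ty} (r : renaming Γ Δ) :
    renaming (σ :: Γ) (σ :: Δ) :=
  on_head (F := var (σ :: Δ)) vz (fun _ v => vs (r _ v)).

Definition ren_nil {Γ} : renaming [] Γ :=
  fun σ v => match v in var Δ _ return
               match Δ with [] => var Γ σ | _ :: _ => unit end
             with vz => tt | vs _ => tt end.

Fixpoint tren {Γ Δ} (r : renaming Γ Δ) {σ} (t : tm Γ σ) : tm Δ σ :=
  match t with
  | Var v => Var (r _ v)
  | Cst c => Cst c
  | App f a => App (tren r f) (tren r a)
  end.

Fixpoint tsub {Γ Δ} (s : substitution Γ Δ) {σ} (t : tm Γ σ) : tm Δ σ :=
  match t with
  | Var v => s _ v
  | Cst c => Cst c
  | App f a => App (tsub s f) (tsub s a)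
  end.

Definition wk {Γ} {ρ σ : ty} (t : tm Γ σ) : tm (ρ :: Γ) σ := tren shift t.

Definition sub_up {Γ Δ} {σ : ty} (s : substitution Γ Δ) :
    substitution (σ :: Γ) (σ :: Δ) :=
  on_head (F := tm (σ :: Δ)) v0 (fun _ v => wk (s _ v)).

(** Bracket abstraction; the calculus itself has no λ.  Subterms without the
    abstracted variable are not taken apart, which keeps terms small when
    abstractions are nested. *)
Fixpoint strengthen {Γ} {ρ τ : ty} (t : tm (ρ :: Γ) τ) : option (tm Γ τ) :=
  match t with
  | Var v =>
      on_head (F := fun τ => option (tm Γ τ))
        None (fun _ v' => Some (Var v')) v
  | Cst c => Some (Cst c)
  | App f a =>
      match strengthen f, strengthen a with
      | Some f', Some a' => Some (f' · a')
      | _, _ => None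
      end
  end.

Fixpoint lam {Γ} {ρ τ : ty} (t : tm (ρ :: Γ) τ) : tm Γ (ρ ⇒ τ) :=
  match t with
  | Var v =>
      on_head (F := fun τ => tm Γ (ρ ⇒ τ))
        (cS · cK · cK (τ := ρ)) (fun _ v' => cK · Var v') v
  | Cst c => cK · Cst c
  | App f a =>
      match strengthen (f · a) with
      | Some t' => cK · t'
      | None => cS · lam f · lam a
      end
  end.

(** Equality is primitive at type [N] only. *)
Inductive fm : ctx -> Type :=
| Bot {Γ} : fm Γ
| Eq {Γ} : tm Γ N -> tm Γ N -> fm Γ
| St {Γ} {σ : ty} : tm Γ σ -> fm Γ
| Imp {Γ} : fm Γ -> fm Γ -> fm Γ
| And {Γ} : fm Γ -> fm Γ -> fm Γ
| Or {Γ} : fm Γ -> fm Γ -> fm Γ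
| All {Γ} (σ : ty) : fm (σ :: Γ) -> fm Γ
| Ex {Γ} (σ : ty) : fm (σ :: Γ) -> fm Γ.

Declare Scope fm_scope.
Delimit Scope fm_scope with fm.
Bind Scope fm_scope with fm.
Notation "s ≐ t" := (Eq s t) (at level 70) : fm_scope.
Notation "A ⟶ B" := (Imp A B) (at level 80, right associativity) : fm_scope.
Notation "A ⩑ B" := (And A B) (at level 74, right associativity) : fm_scope.
Local Open Scope fm_scope.

Fixpoint fren {Γ Δ} (r : renaming Γ Δ) (A : fm Γ) {struct A} : fm Δ :=
  match A in fm Γ' return renaming Γ' Δ -> fm Δ with
  | Bot => fun _ => Bot
  | Eq s t => fun r => Eq (tren r s) (tren r t)
  | St t => fun r => St (tren r t)
  | Imp A B => fun r => Imp (fren r A) (fren r B)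
  | And A B => fun r => And (fren r A) (fren r B)
  | Or A B => fun r => Or (fren r A) (fren r B)
  | All A => fun r => All (fren (ren_up r) A)
  | Ex A => fun r => Ex (fren (ren_up r) A)
  end r.

Fixpoint fsub {Γ Δ} (s : substitution Γ Δ) (A : fm Γ) {struct A} : fm Δ :=
  match A in fm Γ' return substitution Γ' Δ -> fm Δ with
  | Bot => fun _ => Bot
  | Eq a b => fun s => Eq (tsub s a) (tsub s b)
  | St a => fun s => St (tsub s a)
  | Imp A B => fun s => Imp (fsub s A) (fsub s B)
  | And A B => fun s => And (fsub s A) (fsub s B)
  | Or A B => fun s => Or (fsub s A) (fsub s B)
  | All A => fun s => All (fsub (sub_up s) A)
  | Ex A => fun s => Ex (fsub (sub_up s) A)
  end s.

Definition inst {Γ} {σ : ty} (A : fm (σ :: Γ)) (t : tm Γ σ) : fm Γ :=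
  fsub (on_head (F := tm Γ) t (fun _ v => Var v)) A.

(** A(n) becomes A(n+1), still as a formula in the variable n. *)
Definition at_succ {Γ} (A : fm (N :: Γ)) : fm (N :: Γ) :=
  fsub (on_head (F := tm (N :: Γ)) (succ · v0) (fun _ v => Var (vs v))) A.

Fixpoint internal {Γ} (A : fm Γ) : Prop :=
  match A with
  | Bot | Eq _ _ => True
  | St _ => False
  | Imp A B | And A B | Or A B => internal A /\ internal B
  | All A | Ex A => internal A
  end.

Definition all_st {Γ} (σ : ty) (A : fm (σ :: Γ)) : fm Γ := All (St v0 ⟶ A).
Definition ex_st {Γ} (σ : ty) (A : fm (σ :: Γ)) : fm Γ := Ex (St v0 ⩑ A).

(** The operation A ↦ A^st.  Bounded number quantifiers are not primitive in
    this syntax, so every quantifier is relativised; the operation is to be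
    applied to formulas written without them. *)
Fixpoint relativize {Γ} (A : fm Γ) : fm Γ :=
  match A with
  | Bot => Bot
  | Eq s t => Eq s t
  | St t => St t
  | Imp A B => Imp (relativize A) (relativize B)
  | And A B => And (relativize A) (relativize B)
  | Or A B => Or (relativize A) (relativize B)
  | All A => all_st (relativize A)
  | Ex A => ex_st (relativize A)
  end.

Definition add {Γ} : tm Γ (N ⇒ N ⇒ N) :=
  lam (lam (cR · v0 · v1 · lam (lam (succ · v1)))).
Definition pred {Γ} : tm Γ (N ⇒ N) :=
  lam (cR · v0 · zero · lam (lam v0)).
Definition monus {Γ} : tm Γ (N ⇒ N ⇒ N) :=
  lam (lam (cR · v0 · v1 · lam (lam (pred · v1)))).

Definition le0 {Γ} (s t : tm Γ N) : fm Γ := monus · s · t ≐ zero.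

Fixpoint eq_ty {Γ} {σ : ty} : tm Γ σ -> tm Γ σ -> fm Γ :=
  match σ return tm Γ σ -> tm Γ σ -> fm Γ with
  | N => fun s t => s ≐ t
  | ρ ⇒ τ => fun s t => All (eq_ty (wk s · v0 (a := ρ)) (wk t · v0))
  end.

Fixpoint le_ty {Γ} {σ : ty} : tm Γ σ -> tm Γ σ -> fm Γ :=
  match σ return tm Γ σ -> tm Γ σ -> fm Γ with
  | N => fun s t => le0 s t
  | ρ ⇒ τ => fun s t => All (le_ty (wk s · v0 (a := ρ)) (wk t · v0))
  end.

(** In the arrow case [v1] is v and [v0] is u. *)
Fixpoint maj {Γ} {σ : ty} : tm Γ σ -> tm Γ σ -> fm Γ :=
  match σ return tm Γ σ -> tm Γ σ -> fm Γ with
  | N => fun s t => le0 s t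
  | ρ ⇒ τ => fun s t =>
      All (All (maj (σ := ρ) v0 v1 ⟶
        (maj (wk (wk s) · v0) (wk (wk t) · v1) ⩑
         maj (wk (wk t) · v0) (wk (wk t) · v1))))
  end.

(** ∀̃^st, ∃̃^st and ∃y ≤* t. *)
Definition mall_st {Γ} (σ : ty) (A : fm (σ :: Γ)) : fm Γ :=
  all_st (maj v0 v0 ⟶ A).
Definition mex_st {Γ} (σ : ty) (A : fm (σ :: Γ)) : fm Γ :=
  ex_st (maj v0 v0 ⩑ A).
Definition ex_maj {Γ} (σ : ty) (t : tm Γ σ) (A : fm (σ :: Γ)) : fm Γ :=
  Ex (maj v0 (wk t) ⩑ A).

(** A theory is a set of formulas in every context, so that axiom schemata
    may contain arbitrary parameters. *)
Definition theory := forall Γ : ctx, fm Γ -> Prop.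

Inductive derives (Ax : theory) : forall Γ : ctx, list (fm Γ) -> fm Γ -> Prop :=
| d_ax Γ (H : list (fm Γ)) A : Ax Γ A -> derives Ax H A
| d_hyp Γ (H : list (fm Γ)) A : In A H -> derives Ax H A
| d_imp_i Γ (H : list (fm Γ)) A B :
    derives Ax (A :: H) B -> derives Ax H (A ⟶ B)
| d_imp_e Γ (H : list (fm Γ)) A B :
    derives Ax H (A ⟶ B) -> derives Ax H A -> derives Ax H B
| d_and_i Γ (H : list (fm Γ)) A B :
    derives Ax H A -> derives Ax H B -> derives Ax H (A ⩑ B)
| d_and_l Γ (H : list (fm Γ)) A B : derives Ax H (A ⩑ B) -> derives Ax H A
| d_and_r Γ (H : list (fm Γ)) A B : derives Ax H (A ⩑ B) -> derives Ax H B
| d_or_l Γ (H : list (fm Γ)) A B : derives Ax H A -> derives Ax H (Or A B)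
| d_or_r Γ (H : list (fm Γ)) A B : derives Ax H B -> derives Ax H (Or A B)
| d_or_e Γ (H : list (fm Γ)) A B C :
    derives Ax H (Or A B) ->
    derives Ax (A :: H) C -> derives Ax (B :: H) C -> derives Ax H C
| d_all_i Γ (H : list (fm Γ)) σ (A : fm (σ :: Γ)) :
    derives Ax (map (fren shift) H) A -> derives Ax H (All A)
| d_all_e Γ (H : list (fm Γ)) σ (A : fm (σ :: Γ)) (t : tm Γ σ) :
    derives Ax H (All A) -> derives Ax H (inst A t)
| d_ex_i Γ (H : list (fm Γ)) σ (A : fm (σ :: Γ)) (t : tm Γ σ) :
    derives Ax H (inst A t) -> derives Ax H (Ex A)
| d_ex_e Γ (H : list (fm Γ)) σ (A : fm (σ :: Γ)) B :
    derives Ax H (Ex A) ->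
    derives Ax (A :: map (fren shift) H) (fren shift B) -> derives Ax H B
| d_raa Γ (H : list (fm Γ)) A :
    derives Ax ((A ⟶ Bot) :: H) Bot -> derives Ax H A.

Definition proves (Ax : theory) (A : fm []) : Prop := derives Ax [] A.

(** Induction of E-PA^ω is restricted to formulas of its own language. *)
Inductive EPA : theory :=
| ax_refl Γ (s : tm Γ N) : EPA (s ≐ s)
| ax_sym Γ (s t : tm Γ N) : EPA (s ≐ t ⟶ t ≐ s)
| ax_trans Γ (s t u : tm Γ N) : EPA (s ≐ t ⟶ t ≐ u ⟶ s ≐ u)
| ax_succ_0 Γ (s : tm Γ N) : EPA (succ · s ≐ zero ⟶ Bot)
| ax_succ_inj Γ (s t : tm Γ N) : EPA (succ · s ≐ succ · t ⟶ s ≐ t)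
| ax_K Γ ρ τ (x : tm Γ ρ) (y : tm Γ τ) : EPA (eq_ty (cK · x · y) x)
| ax_S Γ δ ρ τ (x : tm Γ (δ ⇒ ρ ⇒ τ)) (y : tm Γ (δ ⇒ ρ)) (z : tm Γ δ) :
    EPA (eq_ty (cS · x · y · z) (x · z · (y · z)))
| ax_R_0 Γ ρ (y : tm Γ ρ) (z : tm Γ (ρ ⇒ N ⇒ ρ)) :
    EPA (eq_ty (cR · zero · y · z) y)
| ax_R_succ Γ ρ (x : tm Γ N) (y : tm Γ ρ) (z : tm Γ (ρ ⇒ N ⇒ ρ)) :
    EPA (eq_ty (cR · (succ · x) · y · z) (z · (cR · x · y · z) · x))
| ax_ext Γ ρ τ (z : tm Γ (ρ ⇒ τ)) (x y : tm Γ ρ) :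
    EPA (eq_ty x y ⟶ eq_ty (z · x) (z · y))
| ax_ind Γ (A : fm (N :: Γ)) :
    internal A -> EPA (inst A zero ⟶ All (A ⟶ at_succ A) ⟶ All A).

Inductive EPAst : theory :=
| ax_EPA Γ (A : fm Γ) : EPA A -> EPAst A
| ax_st_eq Γ σ (x y : tm Γ σ) : EPAst (eq_ty x y ⟶ St x ⟶ St y)
| ax_st_maj Γ σ (x y : tm Γ σ) : EPAst (St y ⟶ maj x y ⟶ St x)
| ax_st_closed Γ σ (t : tm [] σ) : EPAst (St (tren (Δ := Γ) ren_nil t))
| ax_st_app Γ σ τ (z : tm Γ (σ ⇒ τ)) (x : tm Γ σ) :
    EPAst (St z ⟶ St x ⟶ St (z · x))
| ax_ext_ind Γ (A : fm (N :: Γ)) :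
    EPAst (inst A zero ⩑ all_st (A ⟶ at_succ A) ⟶ all_st A).

(** In [ax_mAC] and [ax_real] the formula A(x,y) has y as variable 0 and x as
    variable 1; [fren (ren_up (ren_up shift))] makes room below them for the
    witness f, respectively z. *)
Inductive M : theory :=
| ax_EPAst Γ (A : fm Γ) : EPAst A -> M A
| ax_mAC Γ σ τ (A : fm (τ :: σ :: Γ)) : internal A ->
    M (mall_st (mex_st A) ⟶
       mex_st (σ := σ ⇒ τ) (mall_st (ex_maj (v1 · v0)
         (fren (ren_up (ren_up shift)) A))))
| ax_real Γ σ τ (A : fm (τ :: σ :: Γ)) : internal A ->
    M (All (ex_st A) ⟶
       mex_st (σ := τ) (All (ex_maj v1 (fren (ren_up (ren_up shift)) A))))
| ax_MAJ Γ σ :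
    M (Γ := Γ) (all_st (σ := σ) (ex_st (σ := σ) (maj v1 v0))).

(** Every number codes exactly one finite 0-1 sequence: 0 codes the empty
    sequence and 2s+1+b codes the sequence coded by s followed by the bit b
    (bijective binary numeration). *)
Definition snoc {Γ} : tm Γ (N ⇒ N ⇒ N) :=
  lam (lam (add · (succ · (add · v1 · v1)) · v0)).

Definition parity {Γ} : tm Γ (N ⇒ N) :=
  lam (cR · v0 · zero · lam (lam (monus · one · v1))).
Definition half {Γ} : tm Γ (N ⇒ N) :=
  lam (cR · v0 · zero · lam (lam (add · v1 · (parity · v0)))).

(** The sequence without its last entry; the empty sequence is fixed. *)
Definition belast {Γ} : tm Γ (N ⇒ N) := lam (half · (pred · v0)).

(** [drop_last · k · s] is s without its last k entries. *)
Definition drop_last {Γ} : tm Γ (N ⇒ N ⇒ N) :=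
  lam (lam (cR · v1 · v0 · lam (lam (belast · v1)))).

Definition sg {Γ} : tm Γ (N ⇒ N) := lam (monus · one · (monus · one · v0)).

(** |s| is the number of k < s for which dropping k entries from s leaves a
    nonempty sequence; the bound is harmless as |s| ≤ s in this coding. *)
Definition len {Γ} : tm Γ (N ⇒ N) :=
  lam (cR · v0 · zero · lam (lam (add · v1 · (sg · (drop_last · v0 · v2))))).

(** [take · m · s] is the initial segment of s of length min(m, |s|). *)
Definition take {Γ} : tm Γ (N ⇒ N ⇒ N) :=
  lam (lam (drop_last · (monus · (len · v0) · v1) · v0)).

(** [bar · α · n] is the code of (α(0), ..., α(n-1)). *)
Definition bar {Γ} : tm Γ ((N ⇒ N) ⇒ N ⇒ N) :=
  lam (lam (cR · v0 · zero · lam (lam (snoc · v1 · (Var (vs (vs (vs vz))) · v0))))).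

Definition one1 {Γ} : tm Γ (N ⇒ N) := lam one.

Definition mem {Γ} (s : tm Γ N) (T : tm Γ (N ⇒ N)) : fm Γ := T · s ≐ one.

(** Initial segments of s are exactly the [take · m · s]; here [v1] is s and
    [v0] is m. *)
Definition binary_tree {Γ} (T : tm Γ (N ⇒ N)) : fm Γ :=
  le_ty T one1 ⩑
  All (All (mem v1 (wk (wk T)) ⟶ mem (take · v0 · v1) (wk (wk T)))).

Definition WKL : fm [] :=
  All (σ := N ⇒ N) (binary_tree v0 ⟶
    All (σ := N) (Ex (σ := N) (len · v0 ≐ v1 ⩑ mem v0 v2)) ⟶
    Ex (σ := N ⇒ N) (le_ty v0 one1 ⩑
      All (σ := N) (mem (bar · v1 · v0) v2))).

(* Main.v *)
From Stdlib Require Import List Arith Lia Cantor Classical.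
From Stdlib Require Import ClassicalEpsilon FunctionalExtensionality PropExtensionality Eqdep_dec.
Require Import Defs.
Import ListNotations.
Set Implicit Arguments.
Unset Strict Implicit.
Local Open Scope ty_scope.
Local Open Scope tm_scope.
Local Open Scope fm_scope.

(** Why the system proves weak König's lemma.  Let T be a standard tree that is
    infinite in the sense of the standard world, and suppose that no standard
    binary function is a path, that is, has T (bar x n) = 1 for every standard
    n.  A binary function is majorized by the closed term λi.1, hence is
    standard ([std_binary]); so every binary function x leaves T at some
    standard n.  Realization collects these into one standard bound z: every
    binary x leaves T at some n ≤ z ([realization]).  But T contains a standard
    sequence s of length z, and the function that lists the entries of s stays
    in T up to z, because its initial segments are initial segments of s
    ([Bar_entries]).  This contradiction, carried out in [S_WKL], shows that a
    path exists; being binary, it is standard.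

    The argument is carried out in models and not in the calculus.
    [completeness] is a Henkin completeness theorem for any theory closed under
    substitution: what holds in all its typed applicative structures is
    derivable.  [M_subst] says that the theory at hand is closed under
    substitution.  In a model of E-PA^ω extensional equality is a congruence,
    so one may pass to the quotient ([sem_cls]) and assume that equality is
    identity and that functions are determined by their values.  There a
    primitive recursive term is an ordinary function that satisfies its
    defining equations, and induction is available for every property that an
    internal formula with parameters defines ([induction]).

    The arithmetic of codes comes down to two facts on the length of s, which
    is the number of k < s such that s is nonempty after k entries are dropped:
    dropping |s| entries leaves the empty sequence ([Drop_Len]), and dropping
    fewer does not ([Len_le]). *)

(** * Substitution calculus *)

(** Used at two families: terms, where it extends a substitution, and the
    domains of a structure, where it extends an environment. *)
Definition cons {F : ty -> Type} {σ Γ} (h : F σ) (r : forall τ, var Γ τ -> F τ) :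
    forall τ, var (σ :: Γ) τ -> F τ := on_head h r.

Lemma var_case {σ Γ} (P : forall τ, var (σ :: Γ) τ -> Prop) :
  P σ vz -> (forall τ (v : var Γ τ), P τ (vs v)) -> forall τ v, P τ v.
Proof.
  intros h0 h1 τ v. revert P h0 h1.
  refine (match v as v' in var Δ τ' return
    match Δ return var Δ τ' -> Prop with
    | [] => fun _ => True
    | σ0 :: Γ0 => fun v'' => forall P : forall τ, var (σ0 :: Γ0) τ -> Prop,
         P σ0 vz -> (forall τ (v : var Γ0 τ), P τ (vs v)) -> P τ' v''
    end v' with vz => _ | vs v' => _ end); auto.
Qed.

Lemma var_nil {τ} (v : var [] τ) : False.
Proof.
  exact (match v in var Δ _ return match Δ with [] => False | _ => True end
         with vz => I | vs _ => I end).
Qed.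

Lemma fun_var_cons {F : ty -> Type} {σ Γ} (f g : forall τ, var (σ :: Γ) τ -> F τ) :
  f σ vz = g σ vz -> (forall τ (v : var Γ τ), f τ (vs v) = g τ (vs v)) -> f = g.
Proof.
  intros h0 h1. do 2 (apply functional_extensionality_dep; intro).
  revert x x0. apply (var_case (P := fun τ v => f τ v = g τ v)); assumption.
Qed.

Lemma fun_var_nil {F : ty -> Type} (f g : forall τ, var [] τ -> F τ) : f = g.
Proof.
  do 2 (apply functional_extensionality_dep; intro). destruct (var_nil x0).
Qed.

Definition ids {Γ} : substitution Γ Γ := fun _ v => Var v.
Definition scomp {Γ Δ Θ} (s : substitution Δ Θ) (r : substitution Γ Δ) : substitution Γ Θ :=
  fun _ v => tsub s (r _ v).
Definition of_ren {Γ Δ} (r : renaming Γ Δ) : substitution Γ Δ := fun _ v => Var (r _ v).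

Lemma tren_tsub Γ Δ (r : renaming Γ Δ) σ (t : tm Γ σ) : tren r t = tsub (of_ren r) t.
Proof. induction t; cbn; rewrite ?IHt1, ?IHt2; reflexivity. Qed.

Lemma tsub_tsub Γ Δ Θ (s : substitution Δ Θ) (r : substitution Γ Δ) σ (t : tm Γ σ) :
  tsub s (tsub r t) = tsub (scomp s r) t.
Proof. induction t; cbn; rewrite ?IHt1, ?IHt2; reflexivity. Qed.

Lemma tsub_ids Γ σ (t : tm Γ σ) : tsub ids t = t.
Proof. induction t; cbn; rewrite ?IHt1, ?IHt2; reflexivity. Qed.

Lemma wk_tsub Γ ρ σ (t : tm Γ σ) : wk (ρ := ρ) t = tsub (of_ren shift) t.
Proof. apply tren_tsub. Qed.

Lemma tsub_wk_cons Γ Δ ρ σ (t : tm Γ σ) (u : tm Δ ρ) (s : substitution Γ Δ) :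
  tsub (cons (F := tm Δ) u s) (wk t) = tsub s t.
Proof. rewrite wk_tsub, tsub_tsub. reflexivity. Qed.

Lemma tsub_up_wk Γ Δ ρ σ (t : tm Γ σ) (s : substitution Γ Δ) :
  tsub (sub_up (σ := ρ) s) (wk t) = wk (tsub s t).
Proof.
  unfold sub_up. rewrite tsub_wk_cons, wk_tsub, tsub_tsub. f_equal.
  do 2 (apply functional_extensionality_dep; intro). apply wk_tsub.
Qed.

Lemma sub_up_of_ren Γ Δ σ (r : renaming Γ Δ) :
  sub_up (σ := σ) (of_ren r) = of_ren (ren_up r).
Proof. apply fun_var_cons; reflexivity. Qed.

Lemma sub_up_ids Γ σ : sub_up (σ := σ) (ids (Γ := Γ)) = ids.
Proof. apply fun_var_cons; reflexivity. Qed.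

Lemma sub_up_scomp Γ Δ Θ σ (s : substitution Δ Θ) (r : substitution Γ Δ) :
  scomp (sub_up (σ := σ) s) (sub_up r) = sub_up (scomp s r).
Proof.
  apply fun_var_cons; [reflexivity|]. intros τ v. unfold scomp; cbn. apply tsub_up_wk.
Qed.

(** Renamings are special substitutions, so that [fsub_fsub] alone settles all
    commutation questions. *)
Lemma fren_fsub Γ (A : fm Γ) : forall Δ (r : renaming Γ Δ), fren r A = fsub (of_ren r) A.
Proof.
  induction A; intros Δ r; cbn;
    rewrite ?tren_tsub, ?IHA, ?IHA1, ?IHA2, ?sub_up_of_ren; reflexivity.
Qed.

Lemma fsub_fsub Γ (A : fm Γ) : forall Δ Θ (s : substitution Δ Θ) (r : substitution Γ Δ),
  fsub s (fsub r A) = fsub (scomp s r) A.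
Proof.
  induction A; intros Δ Θ s r; cbn;
    rewrite ?tsub_tsub, ?IHA, ?IHA1, ?IHA2, ?sub_up_scomp; reflexivity.
Qed.

Lemma fsub_ids Γ (A : fm Γ) : fsub ids A = A.
Proof.
  induction A; cbn; rewrite ?tsub_ids, ?sub_up_ids, ?IHA, ?IHA1, ?IHA2; reflexivity.
Qed.

Lemma inst_fsub Γ Δ σ (A : fm (σ :: Γ)) (s : substitution Γ Δ) (t : tm Δ σ) :
  inst (fsub (sub_up s) A) t = fsub (cons (F := tm Δ) t s) A.
Proof.
  unfold inst. rewrite fsub_fsub. f_equal. apply fun_var_cons; [reflexivity|].
  intros τ v. unfold scomp; cbn. unfold sub_up. cbn.
  etransitivity; [apply tsub_wk_cons | apply tsub_ids].
Qed.

Lemma fsub_inst Γ Δ σ (A : fm (σ :: Γ)) (s : substitution Γ Δ) (t : tm Γ σ) :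
  fsub s (inst A t) = inst (fsub (sub_up s) A) (tsub s t).
Proof.
  rewrite inst_fsub. unfold inst. rewrite fsub_fsub. f_equal.
  apply fun_var_cons; reflexivity.
Qed.

Lemma inst_wk Γ σ (A : fm Γ) (t : tm Γ σ) : inst (fren shift A) t = A.
Proof.
  unfold inst. rewrite fren_fsub, fsub_fsub. apply fsub_ids.
Qed.

(** Instantiating a weakened formula with the fresh variable gives the formula
    back; this is how a bound variable is opened under [d_all_i] and
    [d_ex_e]. *)
Lemma inst_up_shift Γ σ (A : fm (σ :: Γ)) : inst (fren (ren_up shift) A) v0 = A.
Proof.
  unfold inst. rewrite fren_fsub, fsub_fsub. rewrite <- (fsub_ids A) at 2. f_equal.
  apply fun_var_cons; reflexivity.
Qed.

Lemma fren_shift_comm Γ σ τ (A : fm Γ) :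
  fren (ren_up (σ := τ) (shift (σ := σ))) (fren shift A) = fren shift (fren shift A).
Proof. rewrite !fren_fsub, !fsub_fsub. reflexivity. Qed.

Lemma at_succ_fsub Γ Δ (A : fm (N :: Γ)) (s : substitution Γ Δ) :
  fsub (sub_up s) (at_succ A) = at_succ (fsub (sub_up s) A).
Proof.
  unfold at_succ. rewrite !fsub_fsub. f_equal.
  apply fun_var_cons; [reflexivity|]. intros τ v. unfold scomp; cbn.
  unfold sub_up; cbn. symmetry. rewrite wk_tsub at 1. rewrite tsub_tsub, wk_tsub. reflexivity.
Qed.

Lemma internal_fsub Γ (A : fm Γ) : forall Δ (s : substitution Γ Δ),
  internal A -> internal (fsub s A).
Proof. induction A; cbn; intuition. Qed.

Lemma fsub_eq_ty Γ Δ (s : substitution Γ Δ) σ (a b : tm Γ σ) :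
  fsub s (eq_ty a b) = eq_ty (tsub s a) (tsub s b).
Proof.
  revert Γ Δ s a b. induction σ; intros; cbn; [reflexivity|].
  rewrite IHσ2. cbn. rewrite !tsub_up_wk. reflexivity.
Qed.

Lemma fsub_maj Γ Δ (s : substitution Γ Δ) σ (a b : tm Γ σ) :
  fsub s (maj a b) = maj (tsub s a) (tsub s b).
Proof.
  revert Γ Δ s a b. induction σ; intros; [reflexivity|].
  cbn [maj fsub]. rewrite !IHσ2, !IHσ1. cbn [tsub]. rewrite !tsub_up_wk. reflexivity.
Qed.

Lemma fsub_ren_up2_shift Γ Δ σ τ ρ (s : substitution Γ Δ) (A : fm (τ :: σ :: Γ)) :
  fsub (sub_up (sub_up (sub_up (σ := ρ) s))) (fren (ren_up (ren_up shift)) A) =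
  fren (ren_up (ren_up shift)) (fsub (sub_up (sub_up s)) A).
Proof.
  rewrite !fren_fsub, !fsub_fsub. f_equal.
  apply fun_var_cons; [reflexivity|]. intros θ v. pattern θ, v.
  apply var_case; [reflexivity|]. clear θ v. intros θ v. unfold scomp. cbn. unfold sub_up; cbn. unfold wk. rewrite !tren_tsub, !tsub_tsub. reflexivity.
Qed.

Definition subst_closed (Ax : theory) :=
  forall Γ Δ (s : substitution Γ Δ) A, Ax Γ A -> Ax Δ (fsub s A).

Lemma EPA_subst : subst_closed EPA.
Proof.
  intros Γ Δ s A h. destruct h; cbn [fsub tsub]; rewrite ?fsub_eq_ty; cbn [tsub]; try (constructor; fail).
  rewrite fsub_inst, at_succ_fsub. apply ax_ind. apply internal_fsub; assumption.
Qed.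

Lemma EPAst_subst : subst_closed EPAst.
Proof.
  intros Γ Δ s A h. destruct h; cbn [fsub tsub]; rewrite ?fsub_eq_ty, ?fsub_maj; try (constructor; fail).
  - apply ax_EPA, EPA_subst, H.
  - rewrite !tren_tsub, tsub_tsub. replace (scomp s (of_ren ren_nil)) with (of_ren (ren_nil (Γ := Δ)))
      by apply fun_var_nil. rewrite <- tren_tsub. apply ax_st_closed.
  - rewrite fsub_inst. unfold all_st; cbn [fsub]. rewrite at_succ_fsub. apply (ax_ext_ind (fsub (sub_up s) A)).
Qed.

(** Each schema is stated for arbitrary terms and formulas in an arbitrary
    context, so that a substitution instance of an axiom is an instance of the
    same schema, once substitution has been pushed through the formulas
    defined by recursion on types. *)
Lemma M_subst : subst_closed M.
Proof.
  intros Γ Δ s A h. destruct h as [Γ A h|Γ σ τ A h|Γ σ τ A h|Γ σ].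
  - apply ax_EPAst, EPAst_subst, h.
  - unfold mall_st, mex_st, all_st, ex_st, ex_maj. cbn [fsub].
    rewrite !fsub_maj, fsub_ren_up2_shift. cbn [tsub].
    apply (ax_mAC (A := fsub (sub_up (sub_up s)) A)). apply internal_fsub, h.
  - unfold mall_st, mex_st, all_st, ex_st, ex_maj. cbn [fsub].
    rewrite !fsub_maj, fsub_ren_up2_shift. cbn [tsub].
    apply (ax_real (A := fsub (sub_up (sub_up s)) A)). apply internal_fsub, h.
  - unfold all_st, ex_st. cbn [fsub]. rewrite !fsub_maj. apply (ax_MAJ Δ σ).
Qed.

(** * Structures *)

(** Equality at type [N] is a relation here because the structure made of terms
    interprets it by derivability; the quotient below turns it into
    identity. *)
Record structure := {
  dom : ty -> Type;
  app : forall σ τ, dom (σ ⇒ τ) -> dom σ -> dom τ;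
  const : forall σ, cst σ -> dom σ;
  eqN : dom N -> dom N -> Prop;
  std : forall σ, dom σ -> Prop }.
Arguments app {_ σ τ} _ _.
Arguments const {_ σ} _.
Arguments eqN {_} _ _.
Arguments std {_ σ} _.

Definition env (S : structure) (Γ : ctx) := forall σ, var Γ σ -> dom S σ.
Definition econs {S : structure} {σ Γ} (x : dom S σ) (ρ : env S Γ) : env S (σ :: Γ) :=
  cons (F := dom S) x ρ.
Definition enil {S : structure} : env S [] :=
  fun σ v => match var_nil v with end.

Fixpoint ev {S : structure} {Γ} (ρ : env S Γ) {σ} (t : tm Γ σ) : dom S σ :=
  match t with
  | Var v => ρ _ v
  | Cst c => const c
  | App f a => app (ev ρ f) (ev ρ a)
  end.

Fixpoint sem {S : structure} {Γ} (A : fm Γ) {struct A} : env S Γ -> Prop :=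
  match A in fm Γ' return env S Γ' -> Prop with
  | Bot => fun _ => False
  | Eq s t => fun ρ => eqN (ev ρ s) (ev ρ t)
  | St t => fun ρ => std (ev ρ t)
  | Imp A B => fun ρ => sem A ρ -> sem B ρ
  | And A B => fun ρ => sem A ρ /\ sem B ρ
  | Or A B => fun ρ => sem A ρ \/ sem B ρ
  | All A => fun ρ => forall x, sem A (econs x ρ)
  | Ex A => fun ρ => exists x, sem A (econs x ρ)
  end.

Definition models (S : structure) (Ax : theory) :=
  forall Γ A, Ax Γ A -> forall ρ : env S Γ, sem A ρ.

Lemma ev_tsub (S : structure) Γ Δ (s : substitution Γ Δ) (ρ : env S Δ) σ (t : tm Γ σ) :
  ev ρ (tsub s t) = ev (fun τ v => ev ρ (s τ v)) t.
Proof. induction t; cbn; rewrite ?IHt1, ?IHt2; reflexivity. Qed.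

Lemma ev_wk (S : structure) Γ σ (x : dom S σ) (ρ : env S Γ) τ (t : tm Γ τ) :
  ev (econs x ρ) (wk t) = ev ρ t.
Proof. rewrite wk_tsub, ev_tsub. reflexivity. Qed.

Lemma sem_fsub (S : structure) Γ (A : fm Γ) : forall Δ (s : substitution Γ Δ) (ρ : env S Δ),
  sem (fsub s A) ρ <-> sem A (fun τ v => ev ρ (s τ v)).
Proof.
  induction A; intros Δ s ρ; cbn; rewrite ?ev_tsub, ?IHA1, ?IHA2; try reflexivity.
  - split; intros h x; specialize (h x); [rewrite IHA in h | rewrite IHA];
      (eapply eq_ind; [exact h | f_equal]);
      apply fun_var_cons; try reflexivity; intros τ v; cbn; rewrite ev_wk; reflexivity.
  - split; intros [x h]; exists x; [rewrite IHA in h | rewrite IHA];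
      (eapply eq_ind; [exact h | f_equal]);
      apply fun_var_cons; try reflexivity; intros τ v; cbn; rewrite ev_wk; reflexivity.
Qed.

Lemma sem_inst (S : structure) Γ σ (A : fm (σ :: Γ)) (t : tm Γ σ) (ρ : env S Γ) :
  sem (inst A t) ρ <-> sem A (econs (ev ρ t) ρ).
Proof.
  unfold inst. rewrite sem_fsub. match goal with |- sem A ?e <-> _ =>
    replace e with (econs (ev ρ t) ρ) end; [reflexivity|].
  apply fun_var_cons; reflexivity.
Qed.

Lemma sem_at_succ (S : structure) Γ (A : fm (N :: Γ)) n (ρ : env S Γ) :
  sem (at_succ A) (econs n ρ) <-> sem A (econs (app (const CSucc) n) ρ).
Proof.
  unfold at_succ. rewrite sem_fsub. match goal with |- sem A ?e <-> _ =>
    replace e with (econs (app (const CSucc) n) ρ) end; [reflexivity|].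
  apply fun_var_cons; reflexivity.
Qed.

Fixpoint ext_eq {S : structure} {σ} : dom S σ -> dom S σ -> Prop :=
  match σ return dom S σ -> dom S σ -> Prop with
  | N => eqN
  | ρ ⇒ τ => fun f g => forall x, ext_eq (app f x) (app g x)
  end.

Lemma sem_eq_ty (S : structure) σ : forall Γ (ρ : env S Γ) (a b : tm Γ σ),
  sem (eq_ty a b) ρ <-> ext_eq (ev ρ a) (ev ρ b).
Proof.
  induction σ; intros Γ ρ a b; cbn; [reflexivity|].
  split; intros h x; specialize (h x); rewrite IHσ2 in *; cbn in *; rewrite !ev_wk in *; exact h.
Qed.

(** * Extensional quotient *)

Section Quotient.
Variable S : structure.
Hypothesis HS : models S EPAst.

Lemma ax_true Γ (A : fm Γ) : EPA A -> forall ρ : env S Γ, sem A ρ.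
Proof. intros h. apply HS, ax_EPA, h. Qed.

Lemma ext_refl σ (x : dom S σ) : ext_eq x x.
Proof.
  induction σ; cbn; [|auto]. exact (ax_true (ax_refl v0) (econs x enil)).
Qed.

Lemma ext_sym σ (x y : dom S σ) : ext_eq x y -> ext_eq y x.
Proof.
  induction σ; cbn; [|auto]. exact (ax_true (ax_sym v1 v0) (econs y (econs x enil))).
Qed.

Lemma ext_trans σ (x y z : dom S σ) : ext_eq x y -> ext_eq y z -> ext_eq x z.
Proof.
  induction σ; cbn; [|eauto].
  exact (ax_true (ax_trans v2 v1 v0) (econs z (econs y (econs x enil)))).
Qed.

Lemma ext_app σ τ (f g : dom S (σ ⇒ τ)) x y :
  ext_eq f g -> ext_eq x y -> ext_eq (app f x) (app g y).
Proof.
  intros h1 h2. apply ext_trans with (app f y); [|apply h1].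
  pose proof (ax_true (ax_ext v2 v1 v0) (econs y (econs x (econs f enil)))) as h.
  cbn [sem] in h. rewrite !sem_eq_ty in h. exact (h h2).
Qed.

Lemma ext_std σ (x y : dom S σ) : ext_eq x y -> std x -> std y.
Proof.
  intros h1 h2.
  pose proof (HS (ax_st_eq v1 v0) (econs y (econs x enil))) as h.
  cbn [sem] in h. rewrite !sem_eq_ty in h. exact (h h1 h2).
Qed.

Definition qdom σ := {c : dom S σ -> Prop | exists x, c = ext_eq x}.
Definition cls {σ} (x : dom S σ) : qdom σ := exist _ (ext_eq x) (ex_intro _ x eq_refl).
Definition rep {σ} (c : qdom σ) : dom S σ :=
  proj1_sig (constructive_indefinite_description _ (proj2_sig c)).

Lemma cls_eq σ (x y : dom S σ) : cls x = cls y <-> ext_eq x y.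
Proof.
  split; intros h.
  - apply (f_equal (fun c => proj1_sig c y)) in h. cbn in h. rewrite h. apply ext_refl.
  - unfold cls. assert (E : ext_eq x = ext_eq y).
    { apply functional_extensionality; intro z. apply propositional_extensionality.
      split; intros h'; eauto using ext_trans, ext_sym. }
    apply eq_sig_hprop; [intros; apply proof_irrelevance | exact E].
Qed.

Lemma cls_rep σ (c : qdom σ) : cls (rep c) = c.
Proof.
  unfold rep. destruct (constructive_indefinite_description _ _) as [x h]. cbn.
  apply eq_sig_hprop; [intros; apply proof_irrelevance | symmetry; exact h].
Qed.

Lemma rep_cls σ (x : dom S σ) : ext_eq (rep (cls x)) x.
Proof. apply cls_eq, cls_rep. Qed.

Definition quotient : structure := {|
  dom := qdom;
  app := fun σ τ f x => cls (app (rep f) (rep x));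
  const := fun σ c => cls (const c);
  eqN := fun x y => x = y;
  std := fun σ x => std (rep x) |}.

Definition env_cls {Γ} (ρ : env S Γ) : env quotient Γ := fun σ v => cls (ρ σ v).

Lemma ev_cls Γ (ρ : env S Γ) σ (t : tm Γ σ) : ev (env_cls ρ) t = cls (ev ρ t).
Proof.
  induction t; try reflexivity. cbn. rewrite IHt1, IHt2. apply cls_eq.
  apply ext_app; apply rep_cls.
Qed.

Lemma env_cls_cons Γ (ρ : env S Γ) σ (x : dom S σ) :
  env_cls (econs x ρ) = econs (S := quotient) (cls x) (env_cls ρ).
Proof. apply fun_var_cons; reflexivity. Qed.

(** The quotient map is onto and preserves and reflects the atomic formulas,
    hence preserves the truth of all formulas. *)
Lemma sem_cls Γ (A : fm Γ) : forall ρ : env S Γ,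
  sem (S := quotient) A (env_cls ρ) <-> sem A ρ.
Proof.
  induction A; intros ρ; cbn; rewrite ?ev_cls, ?IHA1, ?IHA2; try reflexivity.
  - apply (cls_eq (σ := N)).
  - split; apply ext_std; [|apply ext_sym]; apply rep_cls.
  - split; intros h x.
    + rewrite <- IHA, env_cls_cons. apply h.
    + rewrite <- (cls_rep x), <- env_cls_cons, IHA. apply h.
  - split; intros [x h].
    + exists (rep x). rewrite <- IHA, env_cls_cons, cls_rep. exact h.
    + exists (cls x). rewrite <- env_cls_cons, IHA. exact h.
Qed.

Lemma env_cls_surj Γ (ρ : env quotient Γ) : exists ρ' : env S Γ, env_cls ρ' = ρ.
Proof.
  exists (fun σ v => rep (ρ σ v)). do 2 (apply functional_extensionality_dep; intro).
  apply cls_rep.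
Qed.

Lemma quotient_models Ax : models S Ax -> models quotient Ax.
Proof.
  intros h Γ A hA ρ. destruct (env_cls_surj ρ) as [ρ' <-]. apply sem_cls, h, hA.
Qed.

Lemma quotient_ext σ τ (f g : dom quotient (σ ⇒ τ)) :
  (forall x, app f x = app g x) -> f = g.
Proof.
  intros h. rewrite <- (cls_rep f), <- (cls_rep g). apply cls_eq. intro x.
  specialize (h (cls x)). cbn in h. rewrite cls_eq in h.
  eapply ext_trans; [|eapply ext_trans; [exact h|]];
    (apply ext_app; [apply ext_refl|]); [apply ext_sym|]; apply rep_cls.
Qed.
End Quotient.

(** * Countability of the syntax *)

Fixpoint code_ty (σ : ty) : nat :=
  match σ with N => 0 | ρ ⇒ τ => S (to_nat (code_ty ρ, code_ty τ)) end.

Lemma to_nat_pair a b c d : to_nat (a, b) = to_nat (c, d) -> a = c /\ b = d.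
Proof. intros h. apply to_nat_inj in h. split; congruence. Qed.

Lemma code_ty_inj σ τ : code_ty σ = code_ty τ -> σ = τ.
Proof.
  revert τ; induction σ; destruct τ; cbn; try discriminate; [reflexivity|].
  intros h. apply Nat.succ_inj, to_nat_pair in h. destruct h. f_equal; auto.
Qed.

Definition ty_dec (σ τ : ty) : {σ = τ} + {σ <> τ}.
Proof. decide equality. Defined.

Fixpoint code_var {Γ σ} (v : var Γ σ) : nat :=
  match v with vz => 0 | vs v => S (code_var v) end.

(** Type indices differ a priori, so injectivity is stated for the pairs of a
    type and a term; for terms this makes the intermediate type of an
    application recoverable from the code. *)
Lemma code_var_inj Γ σ (v : var Γ σ) : forall τ (w : var Γ τ),
  code_var v = code_var w -> existT (var Γ) σ v = existT (var Γ) τ w.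
Proof.
  induction v; intros τ' w; pattern τ', w; apply var_case; cbn; try discriminate; [reflexivity|].
  clear τ' w. intros τ' w h. apply Nat.succ_inj, IHv in h.
  change (existT (var (σ :: Γ)) τ (vs v)) with
    ((fun p => existT (var (σ :: Γ)) (projT1 p) (vs (projT2 p))) (existT (var Γ) τ v)).
  rewrite h. reflexivity.
Qed.

Definition tag (i a b : nat) : nat := to_nat (i, to_nat (a, b)).
Lemma tag_inj i a b i' a' b' : tag i a b = tag i' a' b' -> i = i' /\ a = a' /\ b = b'.
Proof. intros h. apply to_nat_pair in h as [? h]. apply to_nat_pair in h. tauto. Qed.
Opaque to_nat of_nat.

Definition code_cst {σ} (c : cst σ) : nat :=
  match c with
  | C0 => tag 0 0 0
  | CSucc => tag 1 0 0
  | CK ρ τ => tag 2 (code_ty ρ) (code_ty τ)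
  | CS δ ρ τ => tag 3 (code_ty δ) (to_nat (code_ty ρ, code_ty τ))
  | CR ρ => tag 4 (code_ty ρ) 0
  end.

Lemma code_cst_inj σ (c : cst σ) τ (d : cst τ) :
  code_cst c = code_cst d -> existT cst σ c = existT cst τ d.
Proof.
  destruct c, d; cbn; intros h; apply tag_inj in h as [h0 [h1 h2]]; try discriminate;
    try (apply to_nat_pair in h2 as [h2 h3]); repeat match goal with
      h : code_ty _ = code_ty _ |- _ => apply code_ty_inj in h; subst end; reflexivity.
Qed.

Fixpoint code_tm {Γ σ} (t : tm Γ σ) : nat :=
  match t with
  | Var v => tag 0 (code_var v) 0
  | Cst c => tag 1 (code_cst c) 0
  | App f a => tag 2 (code_tm f) (code_tm a)
  end.

Lemma code_tm_inj Γ σ (t : tm Γ σ) : forall τ (u : tm Γ τ),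
  code_tm t = code_tm u -> existT (tm Γ) σ t = existT (tm Γ) τ u.
Proof.
  induction t; intros τ' u; destruct u; cbn; intros h; apply tag_inj in h as [h0 [h1 h2]];
    try discriminate.
  - apply code_var_inj in h1.
    inversion h1; subst. apply inj_pair2_eq_dec in h1; [|exact ty_dec]. subst; reflexivity.
  - apply code_cst_inj in h1.
    inversion h1; subst. apply inj_pair2_eq_dec in h1; [|exact ty_dec]. subst; reflexivity.
  - apply IHt1 in h1. apply IHt2 in h2. clear h0.
    inversion h1; subst. apply inj_pair2_eq_dec in h1; [|exact ty_dec].
    apply inj_pair2_eq_dec in h2; [|exact ty_dec]. subst; reflexivity.
Qed.

Fixpoint code_fm {Γ} (A : fm Γ) : nat :=
  match A with
  | Bot => tag 0 0 0
  | Eq s t => tag 1 (code_tm s) (code_tm t)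
  | @St _ σ t => tag 2 (code_tm t) 0
  | Imp A B => tag 3 (code_fm A) (code_fm B)
  | And A B => tag 4 (code_fm A) (code_fm B)
  | Or A B => tag 5 (code_fm A) (code_fm B)
  | @All _ σ A => tag 6 (code_ty σ) (code_fm A)
  | @Ex _ σ A => tag 7 (code_ty σ) (code_fm A)
  end.

Lemma code_fm_inj Γ (A B : fm Γ) : code_fm A = code_fm B -> A = B.
Proof.
  revert B; induction A; intros B; destruct B; cbn; intros h; apply tag_inj in h as [h0 [h1 h2]];
    try discriminate; clear h0; try reflexivity.
  - apply code_tm_inj, inj_pair2_eq_dec in h1; [|exact ty_dec].
    apply code_tm_inj, inj_pair2_eq_dec in h2; [|exact ty_dec]. congruence.
  - apply code_tm_inj in h1.
    inversion h1; subst. apply inj_pair2_eq_dec in h1; [|exact ty_dec]. congruence.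
  - f_equal; auto.
  - f_equal; auto.
  - f_equal; auto.
  - apply code_ty_inj in h1; subst. f_equal; auto.
  - apply code_ty_inj in h1; subst. f_equal; auto.
Qed.

(** Any left inverse of the coding will do, hence the choice operator instead of
    a parser. *)
Definition decode {A : Type} (code : A -> nat) (d : A) (n : nat) : A :=
  epsilon (inhabits d) (fun x => code x = n).

Lemma decodeK {A : Type} (code : A -> nat) (d x : A) :
  (forall y z, code y = code z -> y = z) -> decode code d (code x) = x.
Proof.
  intros inj. apply inj.
  exact (epsilon_spec (inhabits d) (fun y => code y = code x) (ex_intro _ x eq_refl)).
Qed.

(** * Completeness *)

(** A term or formula of one context gives one in every larger context of an
    increasing sequence.  Representing it by the family of all these copies, and
    not by a pair of an index and an element, keeps transports along equalities
    of contexts out of everything that follows; the default value [d] fills the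
    stages before the element exists. *)
Section Family.
Variables (X : nat -> Type) (up : forall n, X n -> X (S n)) (d : forall n, X n).

Definition coherent (n : nat) (f : forall m, X m) := forall m, n <= m -> f (S m) = up (f m).

Fixpoint family (n : nat) (x : X n) (m : nat) : X m :=
  match Nat.eq_dec n m with
  | left h => eq_rect n X x m h
  | right _ => match m with 0 => d 0 | S m' => up (family x m') end
  end.

Lemma family_self n (x : X n) : family x n = x.
Proof.
  destruct n; cbn [family]; destruct (Nat.eq_dec _ _) as [h|h]; try easy;
    symmetry; apply eq_rect_eq_dec, Nat.eq_dec.
Qed.

Lemma family_coherent n (x : X n) : coherent n (family x).
Proof.
  intros m h. cbn [family]. destruct (Nat.eq_dec n (S m)); [lia | reflexivity].
Qed.

Lemma family_eq n f : coherent n f -> forall m, n <= m -> family (f n) m = f m.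
Proof.
  intros h m hm. induction hm; [apply family_self|].
  rewrite family_coherent, IHhm, h by assumption. reflexivity.
Qed.
End Family.

Ltac hyp := apply d_hyp; cbn; tauto.

Lemma exfalso_imp Ax Γ (H : list (fm Γ)) A B : derives Ax H ((A ⟶ Bot) ⟶ A ⟶ B).
Proof.
  apply d_imp_i, d_imp_i, d_raa. apply d_imp_e with A; hyp.
Qed.

Lemma weaken_imp Ax Γ (H : list (fm Γ)) A B : derives Ax H (B ⟶ A ⟶ B).
Proof. apply d_imp_i, d_imp_i. hyp. Qed.

Lemma or_neg Ax Γ (H : list (fm Γ)) A B : derives Ax H (Or A B ⟶ (A ⟶ Bot) ⟶ B).
Proof.
  apply d_imp_i, d_imp_i. apply d_or_e with A B; [hyp| |hyp].
  apply d_raa. apply d_imp_e with A; hyp.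
Qed.

(** The classical step that lets witnesses for existential formulas also serve
    as counterexamples to universal ones. *)
Lemma not_ex_not Ax Γ (H : list (fm Γ)) σ (A : fm (σ :: Γ)) :
  derives Ax H ((Ex (A ⟶ Bot) ⟶ Bot) ⟶ All A).
Proof.
  apply d_imp_i, d_all_i, d_raa.
  apply d_imp_e with (fren shift (Ex (A ⟶ Bot))); [hyp|].
  cbn [fren]. apply d_ex_i with v0.
  change (derives Ax ((A ⟶ Bot) :: map (fren shift) ((Ex (A ⟶ Bot) ⟶ Bot) :: H))
    (inst (fren (ren_up shift) (A ⟶ Bot)) v0)).
  rewrite inst_up_shift. hyp.
Qed.

Lemma all_not Ax Γ (H : list (fm Γ)) σ (A : fm (σ :: Γ)) :
  derives Ax H (All (A ⟶ Bot) ⟶ Ex A ⟶ Bot).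
Proof.
  apply d_imp_i, d_imp_i. apply d_ex_e with σ A; [hyp|]. cbn [fren].
  apply d_imp_e with A; [|hyp].
  pattern (A ⟶ Bot) at 2. rewrite <- (inst_up_shift (A ⟶ Bot)). apply d_all_e. hyp.
Qed.

Lemma not_ex_wk Ax Γ (H : list (fm Γ)) (A : fm Γ) :
  derives Ax H ((Ex (σ := N) (fren shift A) ⟶ Bot) ⟶ A ⟶ Bot).
Proof.
  apply d_imp_i, d_imp_i. eapply d_imp_e; [hyp|].
  apply d_ex_i with zero. rewrite inst_wk. hyp.
Qed.

(** All sorts are inhabited, which makes it conservative to add a variable that
    no hypothesis mentions. *)
Fixpoint inhabitant {Γ} (σ : ty) : tm Γ σ :=
  match σ with N => zero | ρ ⇒ τ => cK · inhabitant τ end.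

Definition eventually (P : nat -> Prop) := exists n, forall m, n <= m -> P m.

Lemma eventually_all (P : nat -> Prop) : (forall n, P n) -> eventually P.
Proof. intros h; exists 0; auto. Qed.

Lemma eventually_and (P Q : nat -> Prop) :
  eventually P -> eventually Q -> eventually (fun n => P n /\ Q n).
Proof.
  intros [n h] [m h']. exists (n + m). intros k hk. split; [apply h | apply h']; lia.
Qed.

Lemma eventually_mono (P Q : nat -> Prop) :
  (forall n, P n -> Q n) -> eventually P -> eventually Q.
Proof. intros h [n hn]; exists n; auto. Qed.

(** The contexts [stage n] are fixed in advance: stage n+1 adds one variable, of
    type [sort n], which may become the witness of the existential formula
    [task n].  Every existential formula over some stage is [task n] for a later
    n, at a stage whose new variable has the right type ([task_hit]).  The same
    steps make the theory complete, since a formula A is decided together with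
    the vacuous existential closure of A ([decide]). *)
Section Henkin.
Variables (Ax : theory) (F : fm []).
Hypothesis Ax_subst : subst_closed Ax.
Hypothesis F_underivable : ~ proves Ax F.

(** A step number k codes a type, a stage m and a formula over stage m. *)
Definition sort (k : nat) : ty := decode code_ty N (fst (of_nat k)).

Fixpoint stage (n : nat) : ctx :=
  match n with 0 => [] | S k => sort k :: stage k end.

Definition up_fm (k : nat) (A : fm (stage k)) : fm (stage (S k)) := fren shift A.
Definition up_fm1 (σ : ty) (k : nat) (A : fm (σ :: stage k)) : fm (σ :: stage (S k)) :=
  fren (ren_up shift) A.
Definition up_tm (σ : ty) (k : nat) (t : tm (stage k) σ) : tm (stage (S k)) σ := wk t.

Definition task_at (σ : ty) (k : nat) : fm (σ :: stage k) :=
  let p := of_nat (snd (of_nat k)) in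
  family (X := fun m => fm (σ :: stage m)) (up_fm1 (σ := σ)) (fun _ => Bot)
    (n := fst p) (decode code_fm Bot (snd p)) k.
Definition task (k : nat) : fm (sort k :: stage k) := task_at (sort k) k.

Lemma task_hit σ (B : forall m, fm (σ :: stage m)) n :
  coherent (X := fun m => fm (σ :: stage m)) (up_fm1 (σ := σ)) n B ->
  exists k, n <= k /\
    existT (fun τ => fm (τ :: stage k)) (sort k) (task k) = existT _ σ (B k).
Proof.
  intros h. set (k := to_nat (code_ty σ, to_nat (n, code_fm (B n)))).
  assert (hk : n <= k).
  { pose proof (to_nat_non_decreasing (code_ty σ) (to_nat (n, code_fm (B n)))).
    pose proof (to_nat_non_decreasing n (code_fm (B n))). unfold k; lia. }
  exists k. split; [exact hk|]. unfold task.
  assert (hs : sort k = σ).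
  { unfold sort, k. rewrite cancel_of_to. cbn [fst]. apply decodeK, code_ty_inj. }
  rewrite hs. f_equal. unfold task_at.
  assert (hp : of_nat (snd (of_nat k)) = (n, code_fm (B n))).
  { unfold k. rewrite cancel_of_to. cbn [snd]. apply cancel_of_to. }
  rewrite hp. cbn [fst snd]. rewrite decodeK by apply code_fm_inj.
  apply (@family_eq (fun m => fm (σ :: stage m)) (up_fm1 (σ := σ)) _ n B); assumption.
Qed.

(** If the existential formula is refutable, its negation is recorded all the
    same: later arguments use only that a formula is a member of the hypotheses,
    and membership, unlike derivability, passes to later stages without a
    weakening theorem for the calculus. *)
Fixpoint hyps (n : nat) : list (fm (stage n)) :=
  match n with
  | 0 => [F ⟶ Bot]
  | S k =>
      if excluded_middle_informative (derives Ax (hyps k) (Ex (task k) ⟶ Bot))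
      then map (fren shift) ((Ex (task k) ⟶ Bot) :: hyps k)
      else task k :: map (fren shift) (hyps k)
  end.

Lemma hyps_consistent n : ~ derives Ax (hyps n) Bot.
Proof.
  induction n as [|k IH]; cbn [hyps].
  - intros h. apply F_underivable. apply d_raa, h.
  - destruct (excluded_middle_informative _) as [hd|hd]; intros h.
    + apply IH. apply d_imp_e with (Ex (task k) ⟶ Bot); [|exact hd].
      apply d_imp_i.
      change (derives Ax ((Ex (task k) ⟶ Bot) :: hyps k) (inst Bot (inhabitant (sort k)))).
      apply d_all_e, d_all_i, h.
    + apply hd. apply d_imp_e with (All (task k ⟶ Bot)); [apply all_not|].
      apply d_all_i, d_imp_i, h.
Qed.

Lemma hyps_up n m (A : forall k, fm (stage k)) :
  coherent up_fm n A -> n <= m -> In (A m) (hyps m) ->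
  forall k, m <= k -> derives Ax (hyps k) (A k).
Proof.
  intros hA hm h k hk. apply d_hyp. induction hk as [|k hk IH]; [exact h|].
  rewrite hA by lia. cbn [hyps].
  destruct (excluded_middle_informative _); [apply in_map | right; apply in_map]; [right|]; exact IH.
Qed.

(** Families that agree only from some stage on are different elements here; the
    quotient identifies them. *)
Definition elt (σ : ty) :=
  {f : forall m, tm (stage m) σ | exists n, coherent (up_tm (σ := σ)) n f}.

(** A Henkin witness: the fresh variable of the stage at which the formula is
    treated. *)
Lemma witness σ (B : forall m, fm (σ :: stage m)) n :
  coherent (X := fun m => fm (σ :: stage m)) (up_fm1 (σ := σ)) n B ->
  (exists x : elt σ, eventually (fun k => derives Ax (hyps k) (inst (B k) (proj1_sig x k)))) \/
  eventually (fun k => derives Ax (hyps k) (Ex (B k) ⟶ Bot)).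
Proof.
  intros hB. destruct (task_hit hB) as [k [hk e]].
  assert (σ = sort k) by (apply (f_equal (@projT1 _ _)) in e; symmetry; exact e).
  subst σ. apply inj_pair2_eq_dec in e; [|exact ty_dec].
  assert (hS : hyps (S k) =
      if excluded_middle_informative (derives Ax (hyps k) (Ex (task k) ⟶ Bot))
      then map (fren shift) ((Ex (task k) ⟶ Bot) :: hyps k)
      else task k :: map (fren shift) (hyps k)) by reflexivity.
  destruct (excluded_middle_informative _) as [hd|hd].
  - right. exists (S k).
    apply (hyps_up (n := n) (A := fun k => Ex (B k) ⟶ Bot)); [|lia|].
    + intros m hm. unfold up_fm. cbn [fren]. rewrite hB by assumption. reflexivity.
    + rewrite hS. left. rewrite e, hB by assumption. reflexivity.
  - left. pose (x := family (up_tm (σ := sort k)) (fun _ => inhabitant (sort k))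
      (v0 : tm (stage (S k)) (sort k))).
    assert (hx : coherent (up_tm (σ := sort k)) (S k) x) by apply family_coherent.
    exists (exist _ x (ex_intro _ (S k) hx)). cbn [proj1_sig].
    exists (S k). apply (hyps_up (n := S k) (A := fun m => inst (B m) (x m))); [|lia|].
    + intros m hm. rewrite hB, hx by lia. unfold up_fm, up_fm1, up_tm.
      rewrite !fren_fsub, fsub_inst, sub_up_of_ren, wk_tsub. reflexivity.
    + unfold x. rewrite hS, family_self, hB by assumption.
      left. unfold up_fm1. rewrite e. symmetry. apply inst_up_shift.
Qed.

Lemma decide n (A : forall k, fm (stage k)) :
  coherent up_fm n A ->
  eventually (fun k => derives Ax (hyps k) (A k)) \/
  eventually (fun k => derives Ax (hyps k) (A k ⟶ Bot)).
Proof.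
  intros hA. destruct (witness (σ := N) (n := n) (B := fun k => fren shift (A k))) as [[x h]|h].
  - intros m hm. rewrite hA by assumption. unfold up_fm1, up_fm. symmetry. apply fren_shift_comm.
  - left. revert h. apply eventually_mono. intros k h. rewrite inst_wk in h. exact h.
  - right. revert h. apply eventually_mono. intros k h.
    eapply d_imp_e; [apply not_ex_wk | exact h].
Qed.

Lemma app_coherent σ τ (f : elt (σ ⇒ τ)) (x : elt σ) :
  exists n, coherent (up_tm (σ := τ)) n (fun m => proj1_sig f m · proj1_sig x m).
Proof.
  destruct f as [f [n hf]], x as [x [k hx]]. exists (n + k). intros m hm. cbn.
  rewrite hf, hx by lia. reflexivity.
Qed.

Definition henkin : structure := {|
  dom := elt;
  app := fun σ τ f x => exist _ _ (app_coherent f x);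
  const := fun σ c => exist _ (fun m => Cst c) (ex_intro _ 0 (fun m _ => eq_refl));
  eqN := fun x y => eventually (fun m => derives Ax (hyps m) (proj1_sig x m ≐ proj1_sig y m));
  std := fun σ x => eventually (fun m => derives Ax (hyps m) (St (proj1_sig x m))) |}.

Definition at_stage {Γ} (ρ : env henkin Γ) (m : nat) : substitution Γ (stage m) :=
  fun σ v => proj1_sig (ρ σ v) m.

Lemma ev_henkin Γ (ρ : env henkin Γ) σ (t : tm Γ σ) m :
  proj1_sig (ev ρ t) m = tsub (at_stage ρ m) t.
Proof. induction t; cbn; rewrite <- ?IHt1, <- ?IHt2; reflexivity. Qed.

Lemma env_coherent Γ (ρ : env henkin Γ) : exists n, forall m, n <= m ->
  at_stage ρ (S m) = scomp (of_ren shift) (at_stage ρ m).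
Proof.
  induction Γ as [|σ Γ IH].
  - exists 0. intros. apply fun_var_nil.
  - destruct (IH (fun τ v => ρ τ (vs v))) as [n hn]. destruct (proj2_sig (ρ σ vz)) as [k hk].
    exists (n + k). intros m hm. apply fun_var_cons.
    + unfold at_stage. rewrite hk by lia. apply wk_tsub.
    + intros τ v. specialize (hn m ltac:(lia)). exact (f_equal (fun s => s τ v) hn).
Qed.

Lemma fm_coherent Γ (A : fm Γ) (ρ : env henkin Γ) :
  exists n, coherent up_fm n (fun m => fsub (at_stage ρ m) A).
Proof.
  destruct (env_coherent ρ) as [n hn]. exists n. intros m hm. unfold up_fm.
  rewrite hn, fren_fsub, fsub_fsub by assumption. reflexivity.
Qed.

Lemma fm1_coherent Γ σ (A : fm (σ :: Γ)) (ρ : env henkin Γ) :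
  exists n, coherent (X := fun m => fm (σ :: stage m)) (up_fm1 (σ := σ)) n
    (fun m => fsub (sub_up (at_stage ρ m)) A).
Proof.
  destruct (env_coherent ρ) as [n hn]. exists n. intros m hm. unfold up_fm1.
  rewrite hn, fren_fsub, <- sub_up_of_ren, fsub_fsub, sub_up_scomp by assumption. reflexivity.
Qed.

Lemma at_stage_cons Γ (ρ : env henkin Γ) σ (x : elt σ) m :
  at_stage (econs (S := henkin) x ρ) m = cons (F := tm (stage m)) (proj1_sig x m) (at_stage ρ m).
Proof. apply fun_var_cons; reflexivity. Qed.

Definition holds {Γ} (A : fm Γ) (ρ : env henkin Γ) :=
  eventually (fun m => derives Ax (hyps m) (fsub (at_stage ρ m) A)).

Lemma not_holds_bot Γ (ρ : env henkin Γ) : ~ holds Bot ρ.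
Proof. intros [n h]. exact (hyps_consistent (h n (le_n n))). Qed.

Lemma holds_em Γ (A : fm Γ) (ρ : env henkin Γ) : holds A ρ \/ holds (A ⟶ Bot) ρ.
Proof. destruct (fm_coherent A ρ) as [n hn]. apply (decide hn). Qed.

Lemma holds_mp Γ (A B : fm Γ) (ρ : env henkin Γ) : holds (A ⟶ B) ρ -> holds A ρ -> holds B ρ.
Proof.
  intros h h'. generalize (eventually_and h h'). apply eventually_mono.
  intros m [h1 h2]. eapply d_imp_e; [exact h1 | exact h2].
Qed.

Lemma holds_taut Γ (A : fm Γ) (ρ : env henkin Γ) :
  (forall Δ (s : substitution Γ Δ) H, derives Ax H (fsub s A)) -> holds A ρ.
Proof. intros h. apply eventually_all. intros m. apply h. Qed.

Lemma holds_inst Γ σ (A : fm (σ :: Γ)) (ρ : env henkin Γ) (x : elt σ) :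
  holds (All A) ρ -> holds A (econs (S := henkin) x ρ).
Proof.
  apply eventually_mono. intros m h. rewrite at_stage_cons, <- inst_fsub. apply d_all_e, h.
Qed.

Lemma holds_ex_i Γ σ (A : fm (σ :: Γ)) (ρ : env henkin Γ) (x : elt σ) :
  holds A (econs (S := henkin) x ρ) -> holds (Ex A) ρ.
Proof.
  apply eventually_mono. intros m h. rewrite at_stage_cons, <- inst_fsub in h.
  cbn [fsub]. eapply d_ex_i, h.
Qed.

Lemma holds_ex_e Γ σ (A : fm (σ :: Γ)) (ρ : env henkin Γ) :
  holds (Ex A) ρ -> exists x : elt σ, holds A (econs (S := henkin) x ρ).
Proof.
  intros hE. destruct (fm1_coherent A ρ) as [n hn].
  destruct (witness hn) as [[x h]|h].
  - exists x. revert h. apply eventually_mono. intros m h.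
    rewrite at_stage_cons, <- inst_fsub. exact h.
  - exfalso. apply (@not_holds_bot Γ ρ). apply holds_mp with (Ex A); assumption.
Qed.

Lemma holds_imp_l Γ (A B : fm Γ) (ρ : env henkin Γ) : holds (A ⟶ Bot) ρ -> holds (A ⟶ B) ρ.
Proof. apply holds_mp, holds_taut. intros; apply exfalso_imp. Qed.

(** The universal case is where completeness and witnesses meet: if ∃x¬A is not
    refuted it has a witness, which would falsify A. *)
Lemma truth Γ (A : fm Γ) : forall ρ : env henkin Γ, sem A ρ <-> holds A ρ.
Proof.
  induction A; intros ρ; cbn [sem].
  - split; [easy | apply not_holds_bot].
  - unfold holds. cbn. split; apply eventually_mono; intros m h;
      rewrite !ev_henkin in *; exact h.
  - unfold holds. cbn. split; apply eventually_mono; intros m h;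
      rewrite !ev_henkin in *; exact h.
  - rewrite IHA1, IHA2. split; [|apply holds_mp]. intros h.
    destruct (holds_em A1 ρ) as [h1|h1]; [|apply holds_imp_l, h1].
    apply holds_mp with A2; [|auto]. apply holds_taut. intros; apply weaken_imp.
  - rewrite IHA1, IHA2. split.
    + intros [h1 h2]. generalize (eventually_and h1 h2). apply eventually_mono.
      intros m []. apply d_and_i; assumption.
    + intros h. split; revert h; apply eventually_mono; intros m h.
      * eapply d_and_l, h.
      * eapply d_and_r, h.
  - rewrite IHA1, IHA2. split.
    + intros [h|h]; revert h; apply eventually_mono; intros m h; [apply d_or_l | apply d_or_r]; exact h.
    + intros h. destruct (holds_em A1 ρ) as [h1|h1]; [left; exact h1 | right].
      apply holds_mp with (A1 ⟶ Bot); [|exact h1]. apply holds_mp with (Or A1 A2); [|exact h].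
      apply holds_taut. intros; apply or_neg.
  - split.
    + intros h. destruct (holds_em (Ex (A ⟶ Bot)) ρ) as [hE|hE].
      * apply holds_ex_e in hE as [x hx]. exfalso. apply (@not_holds_bot _ (econs (S := henkin) x ρ)).
        apply holds_mp with A; [exact hx|]. apply IHA, h.
      * apply holds_mp with (Ex (A ⟶ Bot) ⟶ Bot); [|exact hE].
        apply holds_taut. intros. apply not_ex_not.
    + intros h x. apply IHA, holds_inst, h.
  - split.
    + intros [x hx]. apply IHA, holds_ex_i in hx. exact hx.
    + intros h. apply holds_ex_e in h as [x hx]. exists x. apply IHA, hx.
Qed.

Lemma henkin_models : models henkin Ax.
Proof.
  intros Γ A hA ρ. apply truth, eventually_all. intros m. apply d_ax, Ax_subst, hA.
Qed.

Lemma henkin_refutes : ~ sem F (enil (S := henkin)).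
Proof.
  intros h. apply (@not_holds_bot _ (enil (S := henkin))).
  apply holds_mp with F; [|apply truth, h].
  exists 0. change (hyps 0) with [F ⟶ Bot].
  intros m hm.
  pose proof (hyps_up (n := 0) (m := 0) (A := fun k => fsub (at_stage (enil (S := henkin)) k) (F ⟶ Bot))) as h'.
  apply h'; try lia.
  - intros k _. unfold up_fm. rewrite fren_fsub, fsub_fsub. f_equal. apply fun_var_nil.
  - replace (at_stage (enil (S := henkin)) 0) with (ids (Γ := [])) by apply fun_var_nil.
    rewrite fsub_ids. left; reflexivity.
Qed.
End Henkin.

(** The hypotheses of the first stage are just the negation of [F], so the term
    structure of an underivable [F] refutes it. *)
Theorem completeness Ax F : subst_closed Ax ->
  (forall S, models S Ax -> sem F (enil (S := S))) -> proves Ax F.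
Proof.
  intros hAx h. destruct (classic (proves Ax F)) as [|hF]; [assumption|].
  exfalso. apply (henkin_refutes hF), h, henkin_models; assumption.
Qed.

(** * Models with identity *)

Section Model.
Variable S : structure.
Hypothesis S_M : models S M.
Hypothesis S_eq : @eqN S = @eq (dom S N).
Hypothesis S_ext : forall σ τ (f g : dom S (σ ⇒ τ)), (forall x, app f x = app g x) -> f = g.

Local Notation "f @ x" := (app f x) (at level 38, left associativity).
Local Notation "#0" := (const (s := S) C0).
Local Notation "#S" := (app (s := S) (const CSucc)).
Local Notation "#1" := (app (s := S) (const CSucc) (const C0)).

Lemma S_EPA Γ (A : fm Γ) (ρ : env S Γ) : EPA A -> sem A ρ.
Proof. intros h. apply S_M, ax_EPAst, ax_EPA, h. Qed.

Lemma ext_eq_eq σ (x y : dom S σ) : ext_eq x y -> x = y.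
Proof.
  revert x y. induction σ; cbn; intros x y h; [rewrite S_eq in h; exact h|].
  apply S_ext. auto.
Qed.

Lemma S_K ρ τ (x : dom S ρ) (y : dom S τ) : const (CK ρ τ) @ x @ y = x.
Proof.
  pose proof (S_EPA (econs y (econs x enil)) (ax_K v1 v0)) as h.
  rewrite sem_eq_ty in h. exact (ext_eq_eq h).
Qed.

Lemma S_S δ ρ τ (x : dom S (δ ⇒ ρ ⇒ τ)) (y : dom S (δ ⇒ ρ)) (z : dom S δ) :
  const (CS δ ρ τ) @ x @ y @ z = x @ z @ (y @ z).
Proof.
  pose proof (S_EPA (econs z (econs y (econs x enil))) (ax_S v2 v1 v0)) as h.
  rewrite sem_eq_ty in h. exact (ext_eq_eq h).
Qed.

Lemma rec_0 ρ (y : dom S ρ) (z : dom S (ρ ⇒ N ⇒ ρ)) : const (CR ρ) @ #0 @ y @ z = y.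
Proof.
  pose proof (S_EPA (econs z (econs y enil)) (ax_R_0 v1 v0)) as h.
  rewrite sem_eq_ty in h. exact (ext_eq_eq h).
Qed.

Lemma rec_S ρ (y : dom S ρ) (z : dom S (ρ ⇒ N ⇒ ρ)) n :
  const (CR ρ) @ #S n @ y @ z = z @ (const (CR ρ) @ n @ y @ z) @ n.
Proof.
  pose proof (S_EPA (econs z (econs y (econs n enil))) (ax_R_succ v2 v1 v0)) as h.
  rewrite sem_eq_ty in h. exact (ext_eq_eq h).
Qed.

Lemma succ_0 n : #S n <> #0.
Proof.
  pose proof (S_EPA (econs n enil) (ax_succ_0 v0)) as h. cbn in h. rewrite S_eq in h. exact h.
Qed.

Definition definable (P : dom S N -> Prop) :=
  exists Γ (A : fm (N :: Γ)) (ρ : env S Γ), internal A /\ forall n, sem A (econs n ρ) <-> P n.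

Lemma induction (P : dom S N -> Prop) : definable P ->
  P #0 -> (forall n, P n -> P (#S n)) -> forall n, P n.
Proof.
  intros [Γ [A [ρ [hA hP]]]] h0 hS n. apply hP.
  apply (S_EPA ρ (ax_ind hA)).
  - rewrite sem_inst. apply hP, h0.
  - cbn. intros m hm. rewrite sem_at_succ. apply hP, hS, hP, hm.
Qed.

(** ** Bracket abstraction *)

Lemma ev_strengthen Γ ρ τ (t : tm (ρ :: Γ) τ) t' (x : dom S ρ) (e : env S Γ) :
  strengthen t = Some t' -> ev (econs x e) t = ev e t'.
Proof.
  revert t'. induction t; cbn; intros t'.
  - revert t'. pattern σ, v. apply var_case; cbn; [discriminate|].
    intros ? w t' h. injection h as <-. reflexivity.
  - intros h. injection h as <-. reflexivity.
  - destruct (strengthen t1), (strengthen t2); try discriminate.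
    intros h. injection h as <-. cbn. rewrite (IHt1 _ eq_refl), (IHt2 _ eq_refl). reflexivity.
Qed.

Lemma ev_lam Γ ρ τ (t : tm (ρ :: Γ) τ) (x : dom S ρ) (e : env S Γ) :
  ev e (lam t) @ x = ev (econs x e) t.
Proof.
  induction t.
  - pattern σ, v. apply var_case; cbn.
    + rewrite S_S, S_K. reflexivity.
    + intros. apply S_K.
  - cbn. apply S_K.
  - cbn [lam]. destruct (strengthen (t1 · t2)) eqn:h.
    + rewrite (ev_strengthen x e h). cbn. apply S_K.
    + cbn. rewrite S_S, IHt1, IHt2. reflexivity.
Qed.

(** ** Defining equations *)

(** Each closed term denotes the same element in all environments.  These names
    for the elements keep the large combinatory terms folded. *)
Definition f_add := ev (enil (S := S)) add.
Definition f_pred := ev (enil (S := S)) pred.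
Definition f_monus := ev (enil (S := S)) monus.
Definition f_parity := ev (enil (S := S)) parity.
Definition f_half := ev (enil (S := S)) half.
Definition f_belast := ev (enil (S := S)) belast.
Definition f_drop_last := ev (enil (S := S)) drop_last.
Definition f_sg := ev (enil (S := S)) sg.
Definition f_len := ev (enil (S := S)) len.
Definition f_take := ev (enil (S := S)) take.
Definition f_snoc := ev (enil (S := S)) snoc.
Definition f_bar := ev (enil (S := S)) bar.

Lemma ev_add Γ (e : env S Γ) : ev e add = f_add. Proof. reflexivity. Qed.
Lemma ev_pred Γ (e : env S Γ) : ev e pred = f_pred. Proof. reflexivity. Qed.
Lemma ev_monus Γ (e : env S Γ) : ev e monus = f_monus. Proof. reflexivity. Qed.
Lemma ev_parity Γ (e : env S Γ) : ev e parity = f_parity. Proof. reflexivity. Qed.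
Lemma ev_half Γ (e : env S Γ) : ev e half = f_half. Proof. reflexivity. Qed.
Lemma ev_belast Γ (e : env S Γ) : ev e belast = f_belast. Proof. reflexivity. Qed.
Lemma ev_drop_last Γ (e : env S Γ) : ev e drop_last = f_drop_last. Proof. reflexivity. Qed.
Lemma ev_sg Γ (e : env S Γ) : ev e sg = f_sg. Proof. reflexivity. Qed.
Lemma ev_len Γ (e : env S Γ) : ev e len = f_len. Proof. reflexivity. Qed.
Lemma ev_take Γ (e : env S Γ) : ev e take = f_take. Proof. reflexivity. Qed.
Lemma ev_snoc Γ (e : env S Γ) : ev e snoc = f_snoc. Proof. reflexivity. Qed.
Lemma ev_bar Γ (e : env S Γ) : ev e bar = f_bar. Proof. reflexivity. Qed.
Hint Rewrite ev_add ev_pred ev_monus ev_parity ev_half ev_belast ev_drop_last ev_sg ev_len ev_take ev_snoc ev_bar : ev.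

Definition Add a b := f_add @ a @ b.
Definition Pred a := f_pred @ a.
Definition Monus a b := f_monus @ a @ b.
Definition Parity a := f_parity @ a.
Definition Half a := f_half @ a.
Definition Belast a := f_belast @ a.
Definition Drop a b := f_drop_last @ a @ b.
Definition Sg a := f_sg @ a.
Definition Len a := f_len @ a.
Definition Take a b := f_take @ a @ b.
Definition Snoc a b := f_snoc @ a @ b.
Definition Bar a b := f_bar @ a @ b.

(** The recursion that computes [len] runs up to s itself; inductions on it need
    a bound that varies independently of s. *)
Definition len_upto_tm {Γ} : tm (N :: N :: Γ) N :=
  cR · v0 · zero · lam (lam (add · v1 · (sg · (drop_last · v0 · Var (vs (vs (vs vz))))))).
Definition Len_upto a m : dom S N := ev (econs m (econs a enil)) len_upto_tm.

Lemma Add_rec a b : Add a b = const (CR N) @ b @ a @ ev enil (lam (lam (succ · v1))).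
Proof. unfold Add, f_add, add. rewrite !ev_lam. reflexivity. Qed.
Lemma Add_0 a : Add a #0 = a.
Proof. rewrite Add_rec. apply rec_0. Qed.
Lemma Add_S a b : Add a (#S b) = #S (Add a b).
Proof. rewrite !Add_rec, rec_S, !ev_lam. reflexivity. Qed.

Lemma Pred_rec a : Pred a = const (CR N) @ a @ #0 @ ev enil (lam (lam v0)).
Proof. unfold Pred, f_pred, pred. rewrite !ev_lam. reflexivity. Qed.
Lemma Pred_0 : Pred #0 = #0.
Proof. rewrite Pred_rec. apply rec_0. Qed.
Lemma Pred_S a : Pred (#S a) = a.
Proof. rewrite Pred_rec, rec_S, !ev_lam. reflexivity. Qed.

Lemma Monus_rec a b : Monus a b = const (CR N) @ b @ a @ ev enil (lam (lam (pred · v1))).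
Proof. unfold Monus, f_monus, monus. rewrite !ev_lam. reflexivity. Qed.
Lemma Monus_0 a : Monus a #0 = a.
Proof. rewrite Monus_rec. apply rec_0. Qed.
Lemma Monus_S a b : Monus a (#S b) = Pred (Monus a b).
Proof. rewrite !Monus_rec, rec_S, !ev_lam. reflexivity. Qed.

Lemma Parity_rec a :
  Parity a = const (CR N) @ a @ #0 @ ev enil (lam (lam (monus · one · v1))).
Proof. unfold Parity, f_parity, parity. rewrite !ev_lam. reflexivity. Qed.
Lemma Parity_0 : Parity #0 = #0.
Proof. rewrite Parity_rec. apply rec_0. Qed.
Lemma Parity_S a : Parity (#S a) = Monus #1 (Parity a).
Proof. rewrite !Parity_rec, rec_S, !ev_lam. reflexivity. Qed.

Lemma Half_rec a :
  Half a = const (CR N) @ a @ #0 @ ev enil (lam (lam (add · v1 · (parity · v0)))).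
Proof. unfold Half, f_half, half. rewrite !ev_lam. reflexivity. Qed.
Lemma Half_0 : Half #0 = #0.
Proof. rewrite Half_rec. apply rec_0. Qed.
Lemma Half_S a : Half (#S a) = Add (Half a) (Parity a).
Proof. rewrite !Half_rec, rec_S, !ev_lam. reflexivity. Qed.

Lemma Belast_E a : Belast a = Half (Pred a).
Proof. unfold Belast, f_belast, belast. rewrite !ev_lam. reflexivity. Qed.

Lemma Drop_rec k a :
  Drop k a = const (CR N) @ k @ a @ ev enil (lam (lam (belast · v1))).
Proof. unfold Drop, f_drop_last, drop_last. rewrite !ev_lam. reflexivity. Qed.
Lemma Drop_0 a : Drop #0 a = a.
Proof. rewrite Drop_rec. apply rec_0. Qed.
Lemma Drop_S k a : Drop (#S k) a = Belast (Drop k a).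
Proof. rewrite !Drop_rec, rec_S, !ev_lam. reflexivity. Qed.

Lemma Sg_E a : Sg a = Monus #1 (Monus #1 a).
Proof. unfold Sg, f_sg, sg. rewrite !ev_lam. reflexivity. Qed.

Lemma Len_upto_rec a m : Len_upto a m = const (CR N) @ m @ #0 @
  ev (econs a enil) (lam (lam (add · v1 · (sg · (drop_last · v0 · v2))))).
Proof. reflexivity. Qed.
Lemma Len_E a : Len a = Len_upto a a.
Proof. rewrite Len_upto_rec. unfold Len, f_len, len. rewrite !ev_lam. reflexivity. Qed.
Lemma Len_upto_0 a : Len_upto a #0 = #0.
Proof. rewrite Len_upto_rec. apply rec_0. Qed.
Lemma Len_upto_S a m : Len_upto a (#S m) = Add (Len_upto a m) (Sg (Drop m a)).
Proof. rewrite !Len_upto_rec, rec_S, !ev_lam. reflexivity. Qed.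

Lemma Take_E m a : Take m a = Drop (Monus (Len a) m) a.
Proof. unfold Take, f_take, take. rewrite !ev_lam. reflexivity. Qed.

Lemma Snoc_E a b : Snoc a b = Add (#S (Add a a)) b.
Proof. unfold Snoc, f_snoc, snoc. rewrite !ev_lam. reflexivity. Qed.

Lemma Bar_rec x n : Bar x n = const (CR N) @ n @ #0 @
  ev (econs x enil) (lam (lam (snoc · v1 · (v2 · v0)))).
Proof. unfold Bar, f_bar, bar. rewrite !ev_lam. reflexivity. Qed.
Lemma Bar_0 x : Bar x #0 = #0.
Proof. rewrite Bar_rec. apply rec_0. Qed.
Lemma Bar_S x n : Bar x (#S n) = Snoc (Bar x n) (x @ n).
Proof. rewrite !Bar_rec, rec_S, !ev_lam. reflexivity. Qed.

(** ** Arithmetic *)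

(** Proves [definable] from a formula and an environment for its parameters. *)
Ltac by_formula A e :=
  exists _, A, e; split;
    [ cbn [internal]; tauto
    | intros ?; unfold len_upto_tm; cbn [sem ev v0 v1 v2 econs cons on_head zero succ one wk tren shift];
      rewrite ?S_eq; autorewrite with ev; reflexivity].

Ltac induct :=
  match goal with |- forall n, @?P n => apply (induction (P := P)); cbv beta end.

Lemma case_N n : n = #0 \/ exists m, n = #S m.
Proof.
  revert n. induct; [|auto|eauto].
  by_formula (Or (v0 ≐ zero) (Ex (v1 ≐ succ · v0)) : fm [N]) (enil (S := S)).
Qed.

Lemma S_inj a b : #S a = #S b -> a = b.
Proof. intros h. apply (f_equal Pred) in h. rewrite !Pred_S in h. exact h. Qed.

Lemma Add_0_l b : Add #0 b = b.
Proof.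
  revert b. induct.
  - by_formula (add · zero · v0 ≐ v0 : fm [N]) (enil (S := S)).
  - apply Add_0.
  - intros b h. rewrite Add_S, h. reflexivity.
Qed.

Lemma Add_S_l a b : Add (#S a) b = #S (Add a b).
Proof.
  revert b. induct.
  - by_formula (add · (succ · v1) · v0 ≐ succ · (add · v1 · v0) : fm [N; N]) (econs a enil).
  - rewrite !Add_0. reflexivity.
  - intros b h. rewrite !Add_S, h. reflexivity.
Qed.

Lemma Add_assoc a b c : Add (Add a b) c = Add a (Add b c).
Proof.
  revert c. induct.
  - by_formula (add · (add · v1 · v2) · v0 ≐ add · v1 · (add · v2 · v0) : fm [N; N; N])
      (econs a (econs b enil)).
  - rewrite !Add_0. reflexivity.
  - intros c h. rewrite !Add_S, h. reflexivity.
Qed.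

Lemma Add_comm a b : Add a b = Add b a.
Proof.
  revert b. induct.
  - by_formula (add · v1 · v0 ≐ add · v0 · v1 : fm [N; N]) (econs a enil).
  - rewrite Add_0, Add_0_l. reflexivity.
  - intros b h. rewrite Add_S, Add_S_l, h. reflexivity.
Qed.

Lemma Add_cancel a b : Add b a = a -> b = #0.
Proof.
  revert a. induct.
  - by_formula (add · v1 · v0 ≐ v0 ⟶ v1 ≐ zero : fm [N; N]) (econs b enil).
  - rewrite Add_0. auto.
  - intros a h. rewrite Add_S. intros h'. apply h, S_inj, h'.
Qed.

Lemma Add_eq_0 a b : Add a b = #0 -> a = #0.
Proof.
  destruct (case_N b) as [->|[c ->]].
  - rewrite Add_0. auto.
  - rewrite Add_S. intros h. destruct (succ_0 h).
Qed.

Definition Le a b := exists c, Add a c = b.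

Lemma Le_refl a : Le a a.
Proof. exists #0. apply Add_0. Qed.

Lemma Le_trans a b c : Le a b -> Le b c -> Le a c.
Proof. intros [x <-] [y <-]. exists (Add x y). symmetry. apply Add_assoc. Qed.

Lemma Le_S a : Le a (#S a).
Proof. exists #1. rewrite Add_S, Add_0. reflexivity. Qed.

Lemma Le_S_S a b : Le a b -> Le (#S a) (#S b).
Proof. intros [c <-]. exists c. apply Add_S_l. Qed.

Lemma Le_0 b : Le #0 b.
Proof. exists b. apply Add_0_l. Qed.

Lemma not_Le_S a : ~ Le (#S a) a.
Proof.
  intros [c h]. rewrite Add_S_l, <- Add_S, Add_comm in h. apply Add_cancel in h.
  exact (succ_0 h).
Qed.

Lemma Le_total a b : Le a b \/ Le (#S b) a.
Proof.
  revert a. induct.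
  - by_formula (Or (Ex (add · v1 · v0 ≐ v2)) (Ex (add · (succ · v2) · v0 ≐ v1)) : fm [N; N])
      (econs b enil).
  - left. apply Le_0.
  - intros a [[c hc]|h].
    + destruct (case_N c) as [->|[d ->]].
      * right. rewrite Add_0 in hc. subst. apply Le_refl.
      * left. exists d. rewrite Add_S_l, <- Add_S. exact hc.
    + right. apply Le_trans with a; [exact h | apply Le_S].
Qed.

Lemma Monus_S_S a b : Monus (#S a) (#S b) = Monus a b.
Proof.
  revert b. induct.
  - by_formula (monus · (succ · v1) · (succ · v0) ≐ monus · v1 · v0 : fm [N; N]) (econs a enil).
  - rewrite Monus_S, !Monus_0. apply Pred_S.
  - intros b h. rewrite Monus_S, h, Monus_S. reflexivity.
Qed.

Lemma Monus_0_l b : Monus #0 b = #0.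
Proof.
  revert b. induct.
  - by_formula (monus · zero · v0 ≐ zero : fm [N]) (enil (S := S)).
  - apply Monus_0.
  - intros b h. rewrite Monus_S, h. apply Pred_0.
Qed.

Lemma Monus_Add a b : Monus (Add a b) b = a.
Proof.
  revert b. induct.
  - by_formula (monus · (add · v1 · v0) · v0 ≐ v1 : fm [N; N]) (econs a enil).
  - rewrite Monus_0, Add_0. reflexivity.
  - intros b h. rewrite Add_S, Monus_S_S. exact h.
Qed.

Lemma Monus_eq_0 a b : Monus a b = #0 -> Le a b.
Proof.
  intros h. destruct (Le_total a b) as [|[c <-]]; [assumption|].
  rewrite Add_S_l, <- Add_S, Add_comm, Monus_Add in h. destruct (succ_0 h).
Qed.

(** ** Codes of binary sequences *)

Lemma Parity_cases n : Parity n = #0 \/ Parity n = #1.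
Proof.
  revert n. induct.
  - by_formula (Or (parity · v0 ≐ zero) (parity · v0 ≐ one) : fm [N]) (enil (S := S)).
  - left. apply Parity_0.
  - intros n [h|h]; rewrite Parity_S, h; [right | left].
    + apply Monus_0.
    + rewrite Monus_S_S. apply Monus_0.
Qed.

Lemma Half_Parity n : Add (Add (Half n) (Half n)) (Parity n) = n.
Proof.
  revert n. induct.
  - by_formula (add · (add · (half · v0) · (half · v0)) · (parity · v0) ≐ v0 : fm [N]) (enil (S := S)).
  - rewrite Half_0, Parity_0, !Add_0. reflexivity.
  - intros n h. rewrite <- h at 4. rewrite Half_S, Parity_S.
    destruct (Parity_cases n) as [->| ->].
    + rewrite Monus_0, Add_S, !Add_0. reflexivity.
    + rewrite Monus_S_S, Monus_0, !Add_S, !Add_0, Add_S_l. reflexivity.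
Qed.

(** A nonempty code is 2s+1+b, so its predecessor has half s and parity b. *)
Lemma Snoc_Belast s : s <> #0 -> Snoc (Belast s) (Parity (Pred s)) = s.
Proof.
  intros h. destruct (case_N s) as [|[n ->]]; [contradiction|].
  rewrite Belast_E, Pred_S, Snoc_E, Add_S_l, Half_Parity. reflexivity.
Qed.

Lemma Belast_0 : Belast #0 = #0.
Proof. rewrite Belast_E, Pred_0. apply Half_0. Qed.

(** Each dropped entry lowers a nonzero code by at least one. *)
Lemma Drop_small a k : Drop k a = #0 \/ Le (Add (Drop k a) k) a.
Proof.
  revert k. induct.
  - by_formula (Or (drop_last · v0 · v1 ≐ zero)
      (Ex (add · (add · (drop_last · v1 · v2) · v1) · v0 ≐ v2)) : fm [N; N]) (econs a enil).
  - right. rewrite Drop_0, Add_0. apply Le_refl.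
  - intros k h. rewrite Drop_S. destruct (case_N (Drop k a)) as [e|[n e]].
    + left. rewrite e. apply Belast_0.
    + right. destruct h as [h|h]; rewrite e in h; [destruct (succ_0 h)|].
      refine (Le_trans _ h). rewrite e, Belast_E, Pred_S, Add_S, Add_S_l.
      apply Le_S_S. exists (Add (Half n) (Parity n)).
      rewrite <- (Half_Parity n) at 4.
      rewrite !Add_assoc. f_equal. rewrite Add_comm, !Add_assoc. reflexivity.
Qed.

Lemma Drop_self a : Drop a a = #0.
Proof.
  destruct (Drop_small a a) as [h|[c h]]; [exact h|].
  rewrite Add_comm, <- Add_assoc in h. apply Add_cancel in h.
  rewrite Add_comm in h. apply (Add_eq_0 h).
Qed.

Lemma Drop_stays_0 a k j : Drop k a = #0 -> Drop (Add k j) a = #0.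
Proof.
  intros h. revert j. induct.
  - by_formula (drop_last · (add · v1 · v0) · v2 ≐ zero : fm [N; N; N]) (econs k (econs a enil)).
  - rewrite Add_0. exact h.
  - intros j hj. rewrite Add_S, Drop_S, hj. apply Belast_0.
Qed.

Lemma Sg_0 : Sg #0 = #0.
Proof. rewrite Sg_E, Monus_0, Monus_S_S. apply Monus_0. Qed.

Lemma Sg_S n : Sg (#S n) = #1.
Proof. rewrite Sg_E, Monus_S_S, Monus_0_l. apply Monus_0. Qed.

(** By induction on m, the count up to m is m, or dropping that many entries
    leaves nothing.  The second alternative persists, because a larger count
    drops even more. *)
Lemma Drop_Len a : Drop (Len a) a = #0.
Proof.
  assert (h : forall m, Len_upto a m = m \/ Drop (Len_upto a m) a = #0).
  { induct.
    - by_formula (Or (len_upto_tm ≐ v0) (drop_last · len_upto_tm · v1 ≐ zero) : fm [N; N]) (econs a enil).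
    - left. apply Len_upto_0.
    - intros m h. rewrite Len_upto_S. destruct (case_N (Drop m a)) as [e|[n e]]; rewrite e.
      + right. rewrite Sg_0, Add_0. destruct h as [-> |h]; assumption.
      + rewrite Sg_S, Add_S, Add_0. destruct h as [-> |h]; [left; reflexivity | right].
        rewrite Drop_S, h. apply Belast_0. }
  rewrite Len_E. destruct (h a) as [-> |h']; [apply Drop_self | exact h'].
Qed.

(** Beyond k nothing is left to count, and up to k at most k entries are
    counted. *)
Lemma Len_le a k : Drop k a = #0 -> Le (Len a) k.
Proof.
  intros hk. rewrite Len_E.
  assert (h : forall m, Le (Len_upto a m) m /\ Le (Len_upto a m) k).
  { induct.
    - by_formula (And (Ex (add · wk len_upto_tm · v0 ≐ v1))
       (Ex (add · wk len_upto_tm · v0 ≐ Var (vs (vs (vs vz))))) : fm [N; N; N]) (econs a (econs k enil)). 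
    - rewrite Len_upto_0. split; apply Le_0.
    - intros m [h1 h2]. rewrite Len_upto_S.
      assert (h3 : Le (Add (Len_upto a m) (Sg (Drop m a))) (#S m)).
      { destruct (case_N (Drop m a)) as [-> |[n ->]].
        - rewrite Sg_0, Add_0. exact (Le_trans h1 (Le_S m)).
        - rewrite Sg_S, Add_S, Add_0. apply Le_S_S, h1. }
      split; [exact h3|].
      destruct (Le_total k m) as [[j <-]|hm].
      + rewrite (Drop_stays_0 j hk), Sg_0, Add_0. exact h2.
      + exact (Le_trans h3 hm). }
  apply h.
Qed.

(** The i-th entry is the last one of the initial segment of length i+1. *)
Definition entries (s : dom S N) : dom S (N ⇒ N) :=
  ev (econs s enil)
    (lam (parity · (pred · (drop_last · (monus · (len · v1) · (succ · v0)) · v1)))).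

Lemma entries_E s i : entries s @ i = Parity (Pred (Drop (Monus (Len s) (#S i)) s)).
Proof. unfold entries. rewrite ev_lam. reflexivity. Qed.

(** Counting from the end avoids truncated subtraction in the induction: the
    first n entries are what is left after c entries are dropped, where
    c + n = |s|. *)
Lemma Bar_entries s n : Le n (Len s) -> Bar (entries s) n = Take n s.
Proof.
  assert (h : forall n c, Add c n = Len s -> Bar (entries s) n = Drop c s).
  { clear n. induct.
    - by_formula (All (add · v0 · v1 ≐ len · v2 ⟶ bar · Var (vs (vs (vs vz))) · v1 ≐ drop_last · v0 · v2)
         : fm [N; N; N ⇒ N])
        (econs s (econs (entries s) enil)).
    - intros c hc. rewrite Add_0 in hc. subst c. rewrite Bar_0. symmetry. apply Drop_Len.
    - intros n IH c hc. rewrite Bar_S, (IH (#S c)) by (rewrite Add_S_l, <- Add_S; exact hc).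
      rewrite entries_E, <- hc, Monus_Add, Drop_S. apply Snoc_Belast.
      intros h0. apply Len_le in h0. rewrite <- hc, Add_S in h0.
      apply (@not_Le_S c). refine (Le_trans _ h0). apply Le_S_S. exists n; reflexivity. }
  intros [c hc]. rewrite Take_E. apply h.
  rewrite <- hc, (Add_comm n c), Monus_Add. reflexivity.
Qed.

(** ** Weak König's lemma *)

Lemma std_le a b : std b -> Monus a b = #0 -> std a.
Proof.
  intros hb h. pose proof (S_M (ax_EPAst (ax_st_maj v1 v0)) (econs b (econs a enil))) as hM.
  cbn [sem maj le0] in hM. rewrite S_eq in hM. apply hM; [exact hb | exact h].
Qed.

Lemma std_closed σ (t : tm [] σ) : std (ev (enil (S := S)) t).
Proof.
  pose proof (S_M (ax_EPAst (ax_st_closed [] t)) enil) as h.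
  cbn [sem] in h. rewrite tren_tsub, ev_tsub in h.
  eapply eq_ind; [exact h|]. f_equal. apply fun_var_nil.
Qed.

Definition binary (x : dom S (N ⇒ N)) := forall i, Monus (x @ i) #1 = #0.

(** A binary function is majorized by λi.1, a closed term. *)
Lemma std_binary x : binary x -> std x.
Proof.
  intros hx.
  pose proof (S_M (ax_EPAst (ax_st_maj v1 v0)) (econs (ev enil one1) (econs x enil))) as hM.
  apply hM; [apply std_closed|]. intros v u _.
  cbn [sem maj le0]. rewrite S_eq.
  assert (h : forall w, ev (enil (S := S)) one1 @ w = #1) by (intros w; apply (ev_lam one w enil)).
  split; cbn; [rewrite h; apply hx | rewrite !h].
  change (Monus #1 #1 = #0). rewrite Monus_S_S. apply Monus_0.
Qed.

Ltac unfold_sem :=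
  cbn [sem ev v0 v1 v2 cK econs cons on_head zero succ one wk tren shift lam strengthen
       fren ren_up];
  rewrite ?S_eq; autorewrite with ev.

(** The realization axiom for the internal formula saying that x, if binary, is
    not in T at n; for numbers, strong majorizability is ≤. *)
Lemma realization (T : dom S (N ⇒ N)) :
  (forall x, exists n, std n /\ (binary x -> T @ Bar x n = #1 -> False)) ->
  exists z, std z /\
    forall x, exists n, Monus n z = #0 /\ (binary x -> T @ Bar x n = #1 -> False).
Proof.
  pose (A := le_ty v1 one1 ⟶ mem (bar · v1 · v0) v2 ⟶ Bot : fm [N; N ⇒ N; N ⇒ N]).
  assert (hA : internal A) by (cbn; tauto).
  pose proof (S_M (ax_real hA) (econs T enil)) as h. revert h.
  unfold A, mex_st, ex_st, ex_maj, mem, one1.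
  cbn [le_ty maj le0]. unfold le0.
  unfold_sem. setoid_rewrite S_K.
  intros h h0. destruct (h h0) as [z [hz [_ hz']]]. exact (ex_intro _ z (conj hz hz')).
Qed.

Lemma S_WKL : sem (relativize WKL) (enil (S := S)).
Proof.
  unfold WKL, binary_tree, mem, one1.
  cbn [relativize le_ty le0]. unfold all_st, ex_st, le0. unfold_sem.
  intros T _ [_ T_closed] T_infinite.
  change (forall s, std s -> forall m, std m -> T @ s = #1 -> T @ Take m s = #1)
    in T_closed.
  change (forall n, std n -> exists s, std s /\ Len s = n /\ T @ s = #1) in T_infinite.
  destruct (classic (exists x, binary x /\ forall n, std n -> T @ Bar x n = #1))
    as [[x [hx hT]]|no_path].
  - exists x. split; [apply std_binary, hx|]. split; [|exact hT].
    intros i _. rewrite S_K. apply hx.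
  - exfalso. destruct (@realization T) as [z [hz hn]].
    + intros x. destruct (classic (binary x)) as [hx|hx].
      * destruct (not_all_ex_not _ _ (fun h => no_path (ex_intro _ x (conj hx h)))) as [n h].
        apply imply_to_and in h as [h1 h2]. exists n; auto.
      (* any standard number serves when x is not binary *)
      * exists #0. split; [exact (std_closed zero) | contradiction].
    + destruct (T_infinite z hz) as [s [hs [<- hTs]]].
      destruct (hn (entries s)) as [n [hnz h]]. apply h.
      * intros i. rewrite entries_E. destruct (Parity_cases (Pred (Drop (Monus (Len s) (#S i)) s)))
          as [-> | ->]; [apply Monus_0_l | rewrite Monus_S_S; apply Monus_0].
      * rewrite Bar_entries by apply (Monus_eq_0 hnz).
        apply T_closed; [exact hs | exact (std_le hz hnz) | exact hTs].
Qed.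
End Model.

(** * The theorem *)

Theorem corollary1p11 : proves M (relativize WKL).
Proof.
  apply (completeness M_subst). intros S hS.
  assert (hS' : models S EPAst) by (intros Γ A h; apply hS, ax_EPAst, h).
  apply (sem_cls hS' (relativize WKL) enil).
  replace (env_cls (S := S) enil) with (enil (S := quotient S)) by apply fun_var_nil.
  apply S_WKL.
  - exact (quotient_models hS' hS).
  - reflexivity.
  - exact (quotient_ext hS').
Qed.
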